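(* Let $N,T\ge 1$ and $d\ge 1$ be integers, let $F_1,\dots,F_N:\mathbb{R}^d\to\mathbb{R}$ be differentiable, and let $f(\mathbf{x}) := \frac{1}{N}\sum_{n=1}^N F_n(\mathbf{x})$, with minimum value $f^* := \min_{\mathbf{x}} f(\mathbf{x})$. Suppose there are constants $L>0$, $\sigma\ge 0$, $\epsilon\ge 0$ such that for all $n\in\{1,\dots,N\}$ and all $\mathbf{x},\mathbf{y}\in\mathbb{R}^d$: (i) $\|\nabla F_n(\mathbf{x})-\nabla F_n(\mathbf{y})\|\le L\|\mathbf{x}-\mathbf{y}\|$; (ii) the stochastic gradient $\mathbf{g}_n$ satisfies $\mathbb{E}[\mathbf{g}_n(\mathbf{x})]=\nabla F_n(\mathbf{x})$ and $\mathbb{E}[\|\mathbf{g}_n(\mathbf{x})-\nabla F_n(\mathbf{x})\|^2]\le\sigma^2$; (iii) $\|\nabla F_n(\mathbf{x})-\nabla f(\mathbf{x})\|^2\le\epsilon^2$. Let $\{\mathbf{x}_t\},\{\mathbf{r}_t\},\{\mathbf{e}_t^n\}$ be generated by the FlexFL algorithm (defined in the context) with learning rate $\eta>0$ and control parameters $\{q_t^n\}\subset(0,1]$, $\{\mathbf{v}_t^n\}$, $\{\mathbf{u}_t\}$. If $p$ is a constant such that $\frac{1}{N}\sum_{n=1}^N\frac{1}{q_t^n}\le p$ for all $t$, and $\eta\le\frac{1}{4Lp}$, then $$\frac{1}{T}\sum_{t=0}^{T-1}\mathbb{E}\big[\|\nabla f(\mathbf{x}_t)\|^2\big]\le \frac{4(f(\mathbf{x}_0)-f^*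 )}{\eta T}+\frac{4L^2}{T}\sum_{t=0}^{T-1}\mathbb{E}\big[\|\mathbf{r}_t\|^2\big]+\frac{4L^2}{NT}\sum_{t=0}^{T-1}\sum_{n=1}^N\mathbb{E}\big[\|\mathbf{e}_t^n\|^2\big]+\frac{4\eta L(\epsilon^2+\sigma^2)}{NT}\sum_{t=0}^{T-1}\sum_{n=1}^N\mathbb{E}\Big[\frac{1}{q_t^n}\Big].$$
   Context: All norms are Euclidean. The FlexFL algorithm: start from a given $\mathbf{x}_0\in\mathbb{R}^d$ (expectations are over the randomness of the algorithm given $\mathbf{x}_0$), with $\mathbf{r}_0=\mathbf{0}$ (server residual error) and $\mathbf{e}_0^n=\mathbf{0}$ for all $n$ (client residual errors). For $t=0,\dots,T-1$: 1. For each client $n=1,\dots,N$: sample $\mathbb{I}_t^n\sim\mathrm{Bernoulli}(q_t^n)$; set $\mathbf{b}_t^n=\mathbf{e}_t^n-\frac{\eta\,\mathbb{I}_t^n}{q_t^n}\mathbf{g}_n(\mathbf{x}_t)$; set $\mathbf{e}_{t+1}^n=\mathbf{b}_t^n-\mathbf{v}_t^n$. 2. Server: set $\mathbf{a}_t=\mathbf{r}_t+\frac{1}{N}\sum_{n=1}^N\mathbf{v}_t^n$; set $\mathbf{r}_{t+1}=\mathbf{a}_t-\mathbf{u}_t$. 3. Set $\mathbf{x}_{t+1}=\mathbf{x}_t+\mathbf{u}_t$. Probabilistic conventions: the control parameters may be random. The probabilities $q_t^n\in(0,1]$ are determined before the sampling in iteration $t$. Let $\mathcal{F}_t$ denote the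 $\sigma$-algebra of all information available just before the sampling in iteration $t$, so that $\mathbf{x}_t,\mathbf{r}_t,\mathbf{e}_t^n,q_t^n$ are $\mathcal{F}_t$-measurable. Conditionally on $\mathcal{F}_t$, for each $n$, $\mathbb{I}_t^n$ is Bernoulli with parameter $q_t^n$ and is independent of the freshly drawn stochastic gradient $\mathbf{g}_n(\mathbf{x}_t)$, which has conditional mean $\nabla F_n(\mathbf{x}_t)$ and satisfies $\mathbb{E}[\|\mathbf{g}_n(\mathbf{x}_t)-\nabla F_n(\mathbf{x}_t)\|^2\mid\mathcal{F}_t]\le\sigma^2$. The vectors $\mathbf{v}_t^n,\mathbf{u}_t\in\mathbb{R}^d$ are otherwise arbitrary (possibly random, possibly zero); $\mathbf{v}_t^n$ is chosen after $\mathbf{b}_t^n$ is computed and $\mathbf{u}_t$ after $\mathbf{a}_t$ is computed. *)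

(* Defs.v *)
From HB Require Import structures.
From mathcomp Require Import all_boot all_order all_algebra.
From mathcomp Require Import all_classical all_reals all_analysis.
Set Implicit Arguments.
Unset Strict Implicit.
Unset Printing Implicit Defensive.
Import Order.TTheory GRing.Theory Num.Theory.
Import numFieldNormedType.Exports.
Local Open Scope classical_set_scope.
Local Open Scope ring_scope.

(* The library norm on 'rV[R]_d is the sup norm. *)
Definition enorm (R : realType) (d : nat) (v : 'rV[R]_d) : R :=
  Num.sqrt (\sum_(i < d) v 0 i ^+ 2).

Definition gradient (R : realType) (d : nat) (F : 'rV[R]_d -> R)
    (x : 'rV[R]_d) : 'rV[R]_d :=
  \row_(i < d) 'D_(delta_mx 0 i) F x.

Definition average_objective (R : realType) (d N : nat)
    (F : 'I_N -> 'rV[R]_d -> R) (x : 'rV[R]_d) : R :=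
  N%:R^-1 * \sum_(n < N) F n x.

Definition is_minimum (R : realType) (d : nat) (f : 'rV[R]_d -> R) (m : R) :=
  (exists x, f x = m) /\ (forall x, m <= f x).

(* Measurability with respect to a sub-sigma-algebra [G]; for vectors, the
   sigma-algebra generated by the coordinates is the Borel one. *)
Definition sigma_rV (R : realType) (d : nat) (Om : Type) (X : Om -> 'rV[R]_d) :
    set (set Om) :=
  g_sigma_preimage (fun (i : 'I_d) w => X w 0 i).

Definition rV_measurable (R : realType) (d : nat) (Om : Type)
    (G : set (set Om)) (X : Om -> 'rV[R]_d) :=
  sigma_rV X `<=` G.

Definition real_measurable (R : realType) (Om : Type)
    (G : set (set Om)) (X : Om -> R) :=
  preimage_set_system setT X measurable `<=` G.

Definition bool_measurable (Om : Type) (G : set (set Om)) (X : Om -> bool) :=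
  preimage_set_system setT X measurable `<=` G.

(* [Y] is a version of E[X | G].  As usual for a real variable [X] that is only
   sigma-integrable over [G] (integrable on each of countably many events of [G]
   covering the space), the averaging identity is required on the events of [G]
   on which [X] is integrable; if [X] is integrable these are all events. *)
Definition is_cond_expectation (R : realType) (disp : measure_display)
    (Om : measurableType disp) (P : probability Om R) (G : set (set Om))
    (X Y : Om -> R) : Prop :=
  [/\ real_measurable G Y,
      exists A : (set Om)^nat,
        [/\ forall k, G (A k), \bigcup_k A k = setT &
            forall k, P.-integrable (A k) (EFin \o X)] &
      forall A, G A -> P.-integrable A (EFin \o X) ->
        (\int[P]_(w in A) (Y w)%:E = \int[P]_(w in A) (X w)%:E)%E].

(* P(A /\ B | G) = P(A | G) P(B | G) for A in [G1], B in [G2]; the versions of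
   the conditional probabilities always exist and are a.s. unique. *)
Definition cond_independent (R : realType) (disp : measure_display)
    (Om : measurableType disp) (P : probability Om R)
    (G G1 G2 : set (set Om)) : Prop :=
  forall A B, G1 A -> G2 B ->
    exists pA pB : Om -> R,
      [/\ is_cond_expectation P G \1_A pA,
          is_cond_expectation P G \1_B pB &
          is_cond_expectation P G \1_(A `&` B) (pA \* pB)].

(* [g x] is the random vector drawn by the oracle at the point [x]. *)
Definition stochastic_gradient (R : realType) (d : nat)
    (disp : measure_display) (Om : measurableType disp) (P : probability Om R)
    (F : 'rV[R]_d -> R) (sigma : R) (g : 'rV[R]_d -> Om -> 'rV[R]_d) : Prop :=
  forall x,
    [/\ rV_measurable measurable (g x),
        forall i, ('E_P[(fun w => g x w 0 i)%R] = (gradient F x 0 i)%:E)%E &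
        ('E_P[(fun w => enorm (g x w - gradient F x) ^+ 2)%R]
           <= (sigma ^+ 2)%:E)%E].

(* Pathwise recursions.  [g t n] is the oracle of client [n] in iteration [t] (a
   random field), queried at the current iterate. *)
Record flexfl_run (R : realType) (d N T : nat) (Om : Type) (x0 : 'rV[R]_d)
    (eta : R) (g : nat -> 'I_N -> 'rV[R]_d -> Om -> 'rV[R]_d)
    (q : nat -> 'I_N -> Om -> R) (I : nat -> 'I_N -> Om -> bool)
    (e b v : nat -> 'I_N -> Om -> 'rV[R]_d)
    (x r a u : nat -> Om -> 'rV[R]_d) : Prop := FlexFLRun {
  flexfl_x0 : forall w, x 0%N w = x0;
  flexfl_r0 : forall w, r 0%N w = 0;
  flexfl_e0 : forall n w, e 0%N n w = 0;
  flexfl_b : forall t n w, (t < T)%N ->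
    b t n w = e t n w - (eta * (I t n w)%:R / q t n w) *: g t n (x t w) w;
  flexfl_e : forall t n w, (t < T)%N -> e t.+1 n w = b t n w - v t n w;
  flexfl_a : forall t w, (t < T)%N ->
    a t w = r t w + N%:R^-1 *: \sum_(n < N) v t n w;
  flexfl_r : forall t w, (t < T)%N -> r t.+1 w = a t w - u t w;
  flexfl_x : forall t w, (t < T)%N -> x t.+1 w = x t w + u t w
}.

(* [Fil t] is the information available just before the sampling of iteration
   [t]: it contains the state and the probabilities of iteration [t], and
   everything drawn or chosen in the earlier iterations. *)
Record flexfl_information (R : realType) (d N T : nat)
    (disp : measure_display) (Om : measurableType disp)
    (Fil : nat -> set (set Om))
    (g : nat -> 'I_N -> 'rV[R]_d -> Om -> 'rV[R]_d)
    (q : nat -> 'I_N -> Om -> R) (I : nat -> 'I_N -> Om -> bool)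
    (e v : nat -> 'I_N -> Om -> 'rV[R]_d)
    (x r u : nat -> Om -> 'rV[R]_d) : Prop := FlexFLInformation {
  info_sigma_algebra : forall t, sigma_algebra setT (Fil t);
  info_measurable : forall t, Fil t `<=` measurable;
  info_nondecreasing : forall t, Fil t `<=` Fil t.+1;
  info_x : forall t, (t < T)%N -> rV_measurable (Fil t) (x t);
  info_r : forall t, (t < T)%N -> rV_measurable (Fil t) (r t);
  info_e : forall t n, (t < T)%N -> rV_measurable (Fil t) (e t n);
  info_q : forall t n, (t < T)%N -> real_measurable (Fil t) (q t n);
  info_I : forall t n, (t < T)%N -> bool_measurable (Fil t.+1) (I t n);
  info_g : forall t n, (t < T)%N ->
    rV_measurable (Fil t.+1) (fun w => g t n (x t w) w);
  info_v : forall t n, (t < T)%N -> rV_measurable (Fil t.+1) (v t n);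
  info_u : forall t, (t < T)%N -> rV_measurable (Fil t.+1) (u t)
}.

(* Conditional laws of the client's draws; [Fn] is the client's objective, [G]
   its information, [gx] the gradient drawn at the current iterate [x]. *)
Record flexfl_sampling (R : realType) (d : nat) (disp : measure_display)
    (Om : measurableType disp) (P : probability Om R) (G : set (set Om))
    (Fn : 'rV[R]_d -> R) (sigma : R) (q : Om -> R) (I : Om -> bool)
    (x gx : Om -> 'rV[R]_d) : Prop := FlexFLSampling {
  sampling_bernoulli : is_cond_expectation P G (fun w => (I w)%:R) q;
  sampling_independent :
    cond_independent P G (preimage_set_system setT I measurable) (sigma_rV gx);
  sampling_mean : forall i,
    is_cond_expectation P G (fun w => gx w 0 i)
      (fun w => gradient Fn (x w) 0 i);
  sampling_variance : exists2 V : Om -> R,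
    is_cond_expectation P G
      (fun w => enorm (gx w - gradient Fn (x w)) ^+ 2) V &
    {ae P, forall w, V w <= sigma ^+ 2}
}.

(* Main.v *)
(** The virtual iterate y_t = x_t + r_t + N^-1 sum_n e_t^n absorbs all residual
    errors: whatever v and u are, y_{t+1} = y_t - eta N^-1 sum_n (I/q) g_n(x_t).
    Since the gradient of f is L-Lipschitz, the descent lemma at y_t applies.
    Conditionally on F_t the update has mean grad f(x_t), and by convexity its
    second moment is at most N^-1 sum_n (sigma^2 + |grad F_n(x_t)|^2) / q_n (the
    clients need not be independent of one another).  The gap between grad f(x_t)
    and grad f(y_t) is paid by L^2 |y_t - x_t|^2, and eta <= 1/(4Lp) absorbs the
    second-moment term in |grad f(x_t)|^2; then one telescopes E f(y_t).

    If some E|r_t|^2 or E|e_t^n|^2 is infinite, so is the right-hand side.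
    Otherwise every y_t, hence every x_t and every gradient, is square
    integrable by induction on t, as 1/q_n <= N p almost surely. *)
Require Import Defs.
From HB Require Import structures.
From mathcomp Require Import all_boot all_order all_algebra finmap.
From mathcomp Require Import all_classical all_reals all_analysis.
From mathcomp Require Import measurable_realfun ring lra.
Set Implicit Arguments.
Unset Strict Implicit.
Unset Printing Implicit Defensive.
Import Order.TTheory GRing.Theory Num.Theory.
Import numFieldNormedType.Exports.
Local Open Scope classical_set_scope.
Local Open Scope ring_scope.

(** * Euclidean geometry and the descent lemma *)

(** Conditional expectation is available only as an averaging identity over the events of [G], so
    every pull-out becomes an orthogonality statement: E[(X - Y) W] = 0 for [G]-measurable [W],
    proved through simple functions. The obstacle is the product of the coin, [1/q] and the drawn
    gradient. Independence given [G] speaks of pairs of events and brings its own versions of the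
    conditional probabilities, a priori different from [q]. It is upgraded to the fact that [q] is
    also the conditional mean of the coin given the past together with the drawn gradient. The coin
    can then be averaged out first, against anything determined by these two: it cancels [1/q] in
    the mean and, as I^2 = I, turns [1/q^2] into [1/q] in the second moment. Only afterwards is the
    gradient averaged given [G]. The variance hypothesis is one-sided and meets the random weight
    [1/q], so orthogonality is also needed as an inequality for nonnegative weights. *)

Definition dotv (R : realType) (d : nat) (u v : 'rV[R]_d) : R :=
  \sum_(i < d) u 0 i * v 0 i.

Section Vectors.
Context {R : realType} {d : nat}.
Implicit Types (u v w : 'rV[R]_d).

Lemma enorm_ge0 u : 0 <= enorm u.
Proof. exact: sqrtr_ge0. Qed.

Lemma enorm_sqr u : enorm u ^+ 2 = \sum_(i < d) u 0 i ^+ 2.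
Proof. by rewrite sqr_sqrtr// sumr_ge0// => i _; rewrite sqr_ge0. Qed.

Lemma dotvv u : dotv u u = enorm u ^+ 2.
Proof. by rewrite enorm_sqr; apply: eq_bigr => i _; rewrite expr2. Qed.

Lemma dotvDl u v w : dotv (u + v) w = dotv u w + dotv v w.
Proof.
by rewrite -big_split/=; apply: eq_bigr => i _; rewrite mxE mulrDl.
Qed.

Lemma dotvZl k u v : dotv (k *: u) v = k * dotv u v.
Proof. by rewrite mulr_sumr; apply: eq_bigr => i _; rewrite mxE mulrA. Qed.

Lemma dotvC u v : dotv u v = dotv v u.
Proof. by apply: eq_bigr => i _; rewrite mulrC. Qed.

Lemma dotvDr u v w : dotv w (u + v) = dotv w u + dotv w v.
Proof. by rewrite !(dotvC w) dotvDl. Qed.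

Lemma dotvZr k u v : dotv v (k *: u) = k * dotv v u.
Proof. by rewrite !(dotvC v) dotvZl. Qed.

Lemma dotv_sumr I (r : seq I) (a : I -> 'rV[R]_d) u :
  dotv u (\sum_(n <- r) a n) = \sum_(n <- r) dotv u (a n).
Proof.
elim: r => [|n r ih]; last by rewrite !big_cons dotvDr ih.
by rewrite !big_nil /dotv big1// => i _; rewrite mxE mulr0.
Qed.

Lemma enorm_sqrD u v :
  enorm (u + v) ^+ 2 = enorm u ^+ 2 + 2 * dotv u v + enorm v ^+ 2.
Proof. rewrite -!dotvv dotvDl !dotvDr (dotvC v u); ring. Qed.

Lemma enorm_sqrZ k u : enorm (k *: u) ^+ 2 = k ^+ 2 * enorm u ^+ 2.
Proof. by rewrite -!dotvv dotvZl dotvZr mulrA expr2. Qed.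

(** Expand |u - c v|^2 >= 0 and divide by [2 * c]. The free weight [c] makes this a substitute for
    Cauchy-Schwarz. *)
Lemma dotv_amgm c u v : 0 < c ->
  dotv u v <= (c^-1 * enorm u ^+ 2 + c * enorm v ^+ 2) / 2.
Proof.
move=> c0.
have : 0 <= enorm (u + (- c) *: v) ^+ 2 by rewrite sqr_ge0.
rewrite enorm_sqrD enorm_sqrZ dotvZr => h.
rewrite ler_pdivlMr// -(ler_pM2l c0).
have E : enorm u ^+ 2 = c * (c^-1 * enorm u ^+ 2) by rewrite mulVKf ?gt_eqF.
rewrite E in h; nra.
Qed.

Lemma enorm_sqrD_le u v :
  enorm (u + v) ^+ 2 <= 2 * enorm u ^+ 2 + 2 * enorm v ^+ 2.
Proof.
have := dotv_amgm u v ltr01; rewrite enorm_sqrD invr1; lra.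
Qed.

Lemma enorm_sqrN u : enorm (- u) ^+ 2 = enorm u ^+ 2.
Proof. by rewrite -scaleN1r enorm_sqrZ sqrrN expr1n mul1r. Qed.

End Vectors.

(** The variance of the [a n] around their mean [m] is nonnegative. *)
Lemma sqr_mean_le (R : realType) (N : nat) (a : 'I_N -> R) : (0 < N)%N ->
  (N%:R^-1 * \sum_n a n) ^+ 2 <= N%:R^-1 * \sum_n a n ^+ 2.
Proof.
move=> N0; set m := N%:R^-1 * _.
have N0' : (0 : R) < N%:R by rewrite ltr0n.
have sE : \sum_n a n = N%:R * m by rewrite mulVKf// gt_eqF.
have : 0 <= \sum_n (a n - m) ^+ 2 by rewrite sumr_ge0// => n _; rewrite sqr_ge0.
rewrite (eq_bigr (fun n => a n ^+ 2 - 2 * m * a n + m ^+ 2)); last first.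
  by move=> n _; ring.
rewrite big_split sumrB/= -mulr_sumr sE sumr_const card_ord -mulr_natl => h.
by rewrite ler_pdivlMl//; nra.
Qed.

Lemma enorm_mean_le (R : realType) (d N : nat) (a : 'I_N -> 'rV[R]_d) :
  (0 < N)%N ->
  enorm (N%:R^-1 *: \sum_n a n) ^+ 2 <= N%:R^-1 * \sum_n enorm (a n) ^+ 2.
Proof.
move=> N0; rewrite enorm_sqr.
under [X in _ <= _ * X]eq_bigr do rewrite enorm_sqr.
rewrite exchange_big/= mulr_sumr; apply: ler_sum => i _.
by rewrite mxE summxE; exact: sqr_mean_le.
Qed.

Lemma deriveE_gradient (R : realType) (d : nat) (f : 'rV[R]_d -> R) x h :
  differentiable f x -> 'D_h f x = dotv (gradient f x) h.
Proof.
move=> df; rewrite deriveE// [in LHS](row_sum_delta h) linear_sum.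
apply: eq_bigr => i _.
by rewrite linearZ/= mxE deriveE// mulrC.
Qed.

Lemma descent_lemma (R : realType) (d : nat) (f : 'rV[R]_d -> R) (L : R) x y :
  0 < L -> (forall z, differentiable f z) ->
  (forall z w, enorm (gradient f z - gradient f w) ^+ 2
                 <= L ^+ 2 * enorm (z - w) ^+ 2) ->
  f y <= f x + dotv (gradient f x) (y - x) + L / 2 * enorm (y - x) ^+ 2.
Proof.
move=> L0 df lip; set h := y - x.
pose phi (s : R) := f (s *: h + x).
have dphi (s : R) : is_derive s 1 phi (dotv (gradient f (s *: h + x)) h).
  have dr := @diff_derivable _ _ _ f (s *: h + x) h (df _).
  have shift : (fun t : R => t^-1 *: ((phi \o shift s) (t *: (1 : R)) - phi s)) =
      (fun t => t^-1 *: ((f \o shift (s *: h + x)) (t *: h) - f (s *: h + x))).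
    apply/funext => t /=.
    by rewrite /phi [t *: 1]mulr1 scalerDl addrA.
  split.
    by rewrite /derivable shift.
  by rewrite /derive shift -deriveE_gradient.
pose k := enorm h ^+ 2.
(* The quadratic majorant along the segment is subtracted from [phi], so the claim reads
   [psi 1 <= psi 0]. A single mean-value point then replaces integration of the gradient over the
   segment. *)
pose psi (s : R) := phi s - s * dotv (gradient f x) h - L / 2 * k * s ^+ 2.
have dpsi (s : R) : is_derive s 1 psi
    (dotv (gradient f (s *: h + x)) h - dotv (gradient f x) h - L * k * s).
  have := dphi s => ?; rewrite /psi; apply: is_derive_eq.
  by rewrite /GRing.scale/=; field.
have [|c] := @MVT R psi _ 0 1 ltr01 (fun s _ => dpsi s).
  apply: derivable_within_continuous => s _.
  exact: (@ex_derive _ _ _ _ _ _ _ (dpsi s)).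
rewrite in_itv/= => /andP[c0 c1] E.
have : psi 1 - psi 0 <= 0.
  rewrite E subr0 mulr1.
  (* The weight [L * c] is the lossless one: the Lipschitz bound L^2 c^2 k on the gradient
     difference makes both halves of Young's inequality at most L c k / 2, as Cauchy-Schwarz would
     give. *)
  have Lc : 0 < L * c by rewrite mulr_gt0.
  have := dotv_amgm (gradient f (c *: h + x) - gradient f x) h Lc.
  rewrite -[- gradient f x]scaleN1r dotvDl dotvZl scaleN1r.
  have := lip (c *: h + x) x; rewrite addrK enorm_sqrZ -/k => h1 h2.
  have h3 : (L * c)^-1 * enorm (gradient f (c *: h + x) - gradient f x) ^+ 2
      <= L * c * k.
    rewrite ler_pdivrMl//; apply: le_trans h1 _.
    by rewrite le_eqVlt; apply/orP; left; apply/eqP; ring.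
  by rewrite -/k in h2; move: (_ * enorm _ ^+ 2) h2 h3 => X h2 h3; lra.
rewrite /psi /phi scale1r subrK scale0r add0r.
by rewrite -/k expr1n expr0n/=; lra.
Qed.

Section Average.
Context (R : realType) (d N : nat) (F : 'I_N -> 'rV[R]_d -> R).
Hypothesis dF : forall n x, differentiable (F n) x.

Lemma average_objectiveE :
  average_objective F = N%:R^-1 \*: (\sum_(n < N) F n).
Proof. by apply/funext => x; rewrite /average_objective/= fct_sumE. Qed.

Lemma differentiable_average x : differentiable (average_objective F) x.
Proof.
rewrite average_objectiveE; apply: differentiableZ.
exact: differentiable_sum.
Qed.

Lemma gradient_average x : gradient (average_objective F) x =
  N%:R^-1 *: \sum_(n < N) gradient (F n) x.
Proof.
apply/rowP => i; rewrite average_objectiveE !mxE summxE deriveZ; last first.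
  by apply: derivable_sum => n; exact: diff_derivable.
rewrite derive_sum => [|n]; last exact: diff_derivable.
by congr (_ *: _); apply: eq_bigr => n _; rewrite mxE.
Qed.

(** In squared form the Lipschitz bound passes to averages by convexity alone, through
    [enorm_mean_le]. *)
Lemma average_gradient_lipschitz (L : R) : (0 < N)%N ->
  (forall n z w, enorm (gradient (F n) z - gradient (F n) w) ^+ 2
                   <= L ^+ 2 * enorm (z - w) ^+ 2) ->
  forall z w, enorm (gradient (average_objective F) z
                       - gradient (average_objective F) w) ^+ 2
                <= L ^+ 2 * enorm (z - w) ^+ 2.
Proof.
move=> N0 lip z w; rewrite !gradient_average -scalerBr -sumrB.
apply: le_trans (enorm_mean_le _ N0) _.
rewrite ler_pdivrMl ?ltr0n// mulr_natl -[X in _ *+ X]card_ord -sumr_const.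
by apply: ler_sum => n _; exact: lip.
Qed.

End Average.

(** * Integrals and conditional expectations *)

Section RealIntegrals.
Context (R : realType) (disp : measure_display) (Om : measurableType disp)
  (P : {measure set Om -> \bar R}).
Implicit Types (X Y : Om -> R) (A D : set Om).

Lemma integrable_sumR (I : Type) (r : seq I) (X : I -> Om -> R) D :
  measurable D -> (forall i, P.-integrable D (EFin \o X i)) ->
  P.-integrable D (EFin \o (fun w => \sum_(i <- r) X i w)).
Proof.
move=> mD iX; rewrite (_ : _ \o _ = fun w => (\sum_(i <- r) (EFin \o X i) w)%E).
  exact: integrable_sum.
by apply/funext => w; rewrite /= sumEFin.
Qed.

Lemma Rintegral_sum (I : Type) (r : seq I) (X : I -> Om -> R) D :
  measurable D -> (forall i, P.-integrable D (EFin \o X i)) ->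
  \int[P]_(w in D) (\sum_(i <- r) X i w) = \sum_(i <- r) \int[P]_(w in D) X i w.
Proof.
move=> mD iX; elim: r => [|i r ih].
  by under eq_Rintegral do rewrite big_nil; rewrite big_nil /Rintegral integral0.
under eq_Rintegral do rewrite big_cons.
by rewrite big_cons RintegralD// ?ih//; exact: integrable_sumR.
Qed.

Lemma integrableZR X D k : measurable D -> P.-integrable D (EFin \o X) ->
  P.-integrable D (EFin \o (fun w => k * X w)).
Proof. by move=> mD iX; exact: (integrableZl mD k iX). Qed.

Lemma integrableDR X Y D : measurable D -> P.-integrable D (EFin \o X) ->
  P.-integrable D (EFin \o Y) ->
  P.-integrable D (EFin \o (fun w => X w + Y w)).
Proof. by move=> mD iX iY; exact: (integrableD mD iX iY). Qed.

Lemma integrableBR X Y D : measurable D -> P.-integrable D (EFin \o X) ->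
  P.-integrable D (EFin \o Y) ->
  P.-integrable D (EFin \o (fun w => X w - Y w)).
Proof. by move=> mD iX iY; exact: (integrableB mD iX iY). Qed.

Lemma integrableNR X D : measurable D -> P.-integrable D (EFin \o X) ->
  P.-integrable D (EFin \o (fun w => - X w)).
Proof. by move=> mD iX; exact: integrableN iX. Qed.

Lemma RintegralN X D : measurable D -> P.-integrable D (EFin \o X) ->
  \int[P]_(w in D) (- X w) = - \int[P]_(w in D) X w.
Proof.
move=> mD iX; under eq_Rintegral do rewrite -mulN1r.
by rewrite RintegralZl// mulN1r.
Qed.

Lemma integrable_restrictR X A : measurable A ->
  P.-integrable setT (EFin \o X) -> P.-integrable setT (EFin \o (X \_ A)).
Proof.
move=> mA iX; rewrite -restrict_EFin; apply: (integrable_mkcond _ mA).1.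
exact: (integrableS measurableT mA (@subsetT _ _) iX).
Qed.

Lemma ae_le_integrable X Y : measurable_fun setT X ->
  {ae P, forall w, `|X w| <= Y w} ->
  P.-integrable setT (EFin \o Y) -> P.-integrable setT (EFin \o X).
Proof.
move=> mX XY /integrableP[mY iY]; apply/integrableP; split.
  exact/measurable_EFinP.
apply: le_lt_trans iY; apply: ae_ge0_le_integral => //.
- by apply: measurableT_comp => //; exact/measurable_EFinP.
- exact: measurableT_comp.
- apply: filterS XY => w h _ /=; rewrite lee_fin.
  exact: le_trans h (ler_norm _).
Qed.

Lemma ae_le_Rintegral X Y : P.-integrable setT (EFin \o X) ->
  P.-integrable setT (EFin \o Y) -> {ae P, forall w, X w <= Y w} ->
  \int[P]_w X w <= \int[P]_w Y w.
Proof.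
move=> iX iY XY; rewrite -subr_ge0 -RintegralB//.
(* The difference is nonnegative only almost everywhere; its absolute value is so everywhere and has
   the same integral. *)
have -> : \int[P]_w (Y w - X w) = \int[P]_w `|Y w - X w|.
  rewrite /Rintegral; congr fine; apply: ae_eq_integral => //.
  - exact: measurable_int (integrableB measurableT iY iX).
  - have := integrable_norm (integrableB measurableT iY iX).
    exact: measurable_int.
  - by apply: filterS XY => w h _ /=; rewrite ger0_norm// subr_ge0.
by apply: Rintegral_ge0.
Qed.

End RealIntegrals.

(** * Measurability of random vectors and with respect to sub-sigma-algebras *)

Lemma measurable_rV_open (R : realType) (disp : measure_display)
    (Om : measurableType disp) (d : nat) (X : Om -> 'rV[R]_d) (O : set 'rV[R]_d) :
  (forall i, measurable_fun setT (fun w => X w 0 i)) -> open O ->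
  measurable (X @^-1` O).
Proof.
move=> mX oO.
(* [O] is the union of the countably many rational balls it contains. *)
pose c (z : 'rV[rat]_d) : 'rV[R]_d := map_mx ratr z.
pose B (zk : 'rV[rat]_d * nat) := ball (c zk.1) (zk.2.+1%:R^-1 : R).
pose S zk := if `[< B zk `<=` O >] then X @^-1` (B zk) else set0.
suff -> : X @^-1` O = \bigcup_zk S zk.
  apply: countable_bigcupT_measurable => [|zk]; first exact: countableP.
  rewrite /S; case: ifP => // _.
  (* Balls of row vectors are those of the sup norm, hence finitely many conditions on
     coordinates. *)
  have -> : X @^-1` (B zk) = \bigcap_(i in [set: 'I_d])
      ((fun w => X w 0 i) @^-1` ball (c zk.1 0 i) (zk.2.+1%:R^-1 : R)).
    apply/seteqP; split => [w [_ h] i _|w h]; first exact: h.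
    split; first by rewrite invr_gt0.
    by move=> j i; rewrite (ord1 j); exact: h.
  apply: fin_bigcap_measurable => // i _.
  rewrite -[_ @^-1` _]setTI; apply: mX => //.
  exact: open_measurable (ball_open _ _).
apply/seteqP; split => [w Ow|w [zk _]]; last first.
  by rewrite /S; case: ifPn => // /asboolP zO /zO.
have /nbhs_ballP[e /= e0 eO] : nbhs (X w) O by exact: open_nbhs_nbhs.
(* The radius 1/(k+1) is below e/2: a ball of this radius whose rational centre lies that close to
   [X w] contains [X w] and stays within distance [e] of it, hence inside [O]. *)
pose k := Num.truncn (2 / e).
have ke : 2 * k.+1%:R^-1 < e.
  by rewrite ltr_pdivrMr// mulrC -ltr_pdivrMr// truncnS_gt.
have /choice[z hz] : forall i, exists q : rat, ball (X w 0 i) (k.+1%:R^-1 : R) (ratr q).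
  move=> i.
  have [|q] := @rat_in_itvoo R (X w 0 i - k.+1%:R^-1) (X w 0 i + k.+1%:R^-1).
    by rewrite ltrBlDr -addrA ltrDl addr_gt0// invr_gt0.
  rewrite in_itv/= => /andP[q1 q2]; exists q.
  by rewrite /ball/= /ball_/= ltr_distlC q1 q2.
exists (\row_i z i, k) => //; rewrite /S.
have BX : B (\row_i z i, k) (X w).
  apply: ball_sym; split; first by rewrite invr_gt0.
  by move=> j i; rewrite (ord1 j) !mxE; exact: hz.
case: ifPn => // /negP; case; apply/asboolP => y By; apply: eO.
apply: (@le_ball _ _ _ (k.+1%:R^-1 + k.+1%:R^-1)).
  by rewrite -mulr2n -[_ *+ 2]mulr_natl ltW.
by apply: ball_triangle By; exact: ball_sym.
Qed.

Lemma measurable_continuous_rV (R : realType) (disp : measure_display)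
    (Om : measurableType disp) (d : nat) (X : Om -> 'rV[R]_d)
    (phi : 'rV[R]_d -> R) :
  (forall i, measurable_fun setT (fun w => X w 0 i)) -> continuous phi ->
  measurable_fun setT (phi \o X).
Proof.
move=> mX /continuousP cphi; apply: (measurability _ (RGenOpens.measurableE R)).
move=> _ [_ [a [b ->] <-]]; rewrite setTI comp_preimage.
by apply: measurable_rV_open => //; apply: cphi; exact: interval_open.
Qed.

(** Regarding [G] as the sigma-algebra of a measurable space of its own gives access to all closure
    properties of measurable functions for [G]-measurable ones. *)
Lemma real_measurableP (R : realType) (Om : pointedType) (G : set (set Om))
    (X : Om -> R) : sigma_algebra setT G ->
  real_measurable G X <->
  measurable_fun setT (X : g_sigma_algebraType G -> R).
Proof.
move=> sG; split => [mX _ Y mY|mX _ [Y mY <-]].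
  by apply: sub_sigma_algebra; apply: mX; exists Y.
by have := mX measurableT Y mY; rewrite measurable_g_measurableTypeE.
Qed.

Lemma rV_measurableP (R : realType) (Om : pointedType) (d : nat)
    (G : set (set Om)) (X : Om -> 'rV[R]_d) (i : 'I_d) :
  rV_measurable G X -> real_measurable G (fun w => X w 0 i).
Proof.
move=> mX; apply: subset_trans mX => Y mY; apply: sub_sigma_algebra.
by rewrite (bigD1 i)//=; left.
Qed.

Lemma real_measurable_sub (R : realType) (disp : measure_display)
    (Om : measurableType disp) (G : set (set Om)) (X : Om -> R) :
  G `<=` measurable -> real_measurable G X -> measurable_fun setT X.
Proof. by move=> GM mX _ Y mY; apply/GM/mX; exists Y. Qed.

(** * Integrals against weights measurable for a sub-sigma-algebra *)

Section Orthogonality.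
Import HBSimple HBNNSimple.
Context (R : realType) (disp : measure_display) (Om : measurableType disp)
  (P : probability Om R) (G : set (set Om)).
Hypotheses (sG : sigma_algebra setT G) (GM : G `<=` measurable).
Implicit Types (h W : Om -> R).

(** For a simple [W] this is a nonnegative combination of integrals of [h] over events of [G]; the
    general case follows by dominated convergence. [W] may be unbounded, only the product being
    assumed integrable. *)
Lemma integral_cond_le0 h W : P.-integrable setT (EFin \o h) ->
  (forall A, G A -> \int[P]_(w in A) h w <= 0) ->
  real_measurable G W -> (forall w, 0 <= W w) ->
  P.-integrable setT (EFin \o (h \* W)) ->
  \int[P]_w (h w * W w) <= 0.
Proof.
move=> ih h0 GW W0 ihW.
have mW := (real_measurableP W sG).1 GW.
have mWe : measurable_fun setT (EFin \o (W : g_sigma_algebraType G -> R)).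
  exact/measurable_EFinP.
(* The approximation takes place in the measurable space of [G], so that the level sets of each
   [g n] are events of [G]; [f n] is the same function on the original space. *)
pose g := nnsfun_approx measurableT mWe.
pose f n (w : Om) : R := g n w.
have cf w : EFin \o f^~ w @ \oo --> (W w)%:E.
  by apply: cvg_nnsfun_approx => // ? _; rewrite lee_fin.
have cfr w : f^~ w @ \oo --> W w by exact: ((fine_cvgP _ _).1 (cf w)).2.
have fW n w : f n w <= W w.
  rewrite -(cvg_lim _ (cfr w))//.
  apply: (@nondecreasing_cvgn_le _ (fun n => f n w)); last by apply/cvg_ex; exists (W w).
  by move=> m k mk; have /lefP := nd_nnsfun_approx measurableT mWe mk; exact.
have mh : measurable_fun setT h by exact/measurable_EFinP/(measurable_int P).
have mf n : measurable_fun setT (f n).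
  move=> _ Y mY; apply: GM; rewrite -(measurable_g_measurableTypeE sG).
  exact: measurable_funP.
have hfE n : \int[P]_w (h w * f n w) <= 0.
  set s := fset_set (g n @` setT).
  pose A i : set Om := g n @^-1` [set s`_i].
  have GA i : G (A i).
    rewrite -(measurable_g_measurableTypeE sG).
    exact: measurable_funPTI.
  have mA i : measurable (A i) by apply: GM; exact: GA.
  have ihA i : P.-integrable setT (EFin \o (h \_ (A i))).
    exact: integrable_restrictR.
  rewrite (@eq_Rintegral _ _ _ _ _ (fun w : Om => \sum_(i < #|`s|) s`_i * (h \_ (A i)) w)); last first.
    move=> w _; rewrite /f fimfunEord mulr_sumr; apply: eq_bigr => i _.
    rewrite mulrCA; congr (_ * _); rewrite patchE indicE.
    by case: ifPn; rewrite ?mulr1 ?mulr0.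
  rewrite Rintegral_sum// => [|i]; last exact: integrableZR.
  apply: sumr_le0 => i _; rewrite RintegralZl// -Rintegral_mkcond.
  apply: mulr_ge0_le0; last exact: h0.
  have /(mem_nth 0) : (i < size s)%N by [].
  rewrite in_fset_set// inE => -[w _ <-].
  exact: fun_ge0.
(* Since 0 <= f n <= W, all the products [h * f n] are dominated by |h W|. *)
have [] := @dominated_convergence _ _ _ P setT measurableT
  (fun n => EFin \o (fun w => h w * f n w)) (EFin \o (h \* W))
  (EFin \o (fun w => `|h w * W w|)).
- by move=> n; apply/measurable_EFinP; exact: measurable_funM.
- exact: measurable_int ihW.
- apply: aeW => w _ /=; apply: cvg_EFin; first exact: nearW.
  by apply: cvgMl_tmp; exact: cfr.
- exact: integrable_norm.
- apply: aeW => w n _ /=; rewrite lee_fin !normrM ler_wpM2l//.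
  by rewrite !ger0_norm//; exact: fun_ge0.
move=> _ _ cv; rewrite /Rintegral; apply: fine_le0.
rewrite -(cvg_lim _ cv)//; apply: lime_le; first by apply/cvg_ex; eexists; exact: cv.
apply: nearW => n /=.
have := hfE n; rewrite /Rintegral -lee_fin fineK//.
apply: integrable_fin_num => //; apply: (le_integrable _ _ _ ihW) => //.
- by apply/measurable_EFinP; exact: measurable_funM.
- move=> w _ /=; rewrite lee_fin !normrM ler_wpM2l//.
  by rewrite !ger0_norm//; exact: fun_ge0.
Qed.

(** Apply the one-sided version to [h] and to [- h], against the positive and the negative part of
    [W]; both parts are at most |W|, so their products with [h] remain integrable. *)
Lemma integral_cond_eq0 h W : P.-integrable setT (EFin \o h) ->
  (forall A, G A -> \int[P]_(w in A) h w = 0) ->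
  real_measurable G W ->
  P.-integrable setT (EFin \o (h \* W)) ->
  \int[P]_w (h w * W w) = 0.
Proof.
move=> ih h0 GW ihW.
have mW := (real_measurableP W sG).1 GW.
have mWb := real_measurable_sub GM GW.
have mh : measurable_fun setT h by exact/measurable_EFinP/(measurable_int P).
have key V : real_measurable G V -> (forall w, 0 <= V w <= `|W w|) ->
    P.-integrable setT (EFin \o (h \* V)) /\ \int[P]_w (h w * V w) = 0.
  move=> GV V01.
  have V0 w : 0 <= V w by case/andP: (V01 w).
  have ihV : P.-integrable setT (EFin \o (h \* V)).
    apply: (le_integrable _ _ _ ihW) => //.
      apply/measurable_EFinP; apply: measurable_funM => //.
      exact: real_measurable_sub GV.
    move=> w _ /=; rewrite lee_fin !normrM ler_wpM2l//.
    by rewrite ger0_norm//; case/andP: (V01 w).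
  split => //; apply/eqP; rewrite eq_le integral_cond_le0//=; last first.
    by move=> A /h0 ->.
  rewrite -oppr_le0 -RintegralN//.
  under eq_Rintegral do rewrite -mulNr.
  apply: (@integral_cond_le0 (fun w => - h w)) => //.
  - exact: integrableNR.
  - move=> A GA; rewrite RintegralN ?h0 ?oppr0//; first exact: GM.
    by apply: integrableS ih => //; exact: GM.
  - rewrite (_ : _ \o _ = EFin \o (fun w => - (h w * V w))).
      exact: integrableNR.
    by apply/funext => w /=; rewrite mulNr.
have [ip p0] : P.-integrable setT (EFin \o (h \* W^\+)) /\
    \int[P]_w (h w * W^\+ w) = 0.
  apply: key => [|w].
    apply/(real_measurableP _ sG); exact: measurable_funrpos.
  rewrite /funrpos le_max lexx orbT/= ge_max normr_ge0 andbT; exact: ler_norm.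
have [in_ n0] : P.-integrable setT (EFin \o (h \* W^\-)) /\
    \int[P]_w (h w * W^\- w) = 0.
  apply: key => [|w].
    apply/(real_measurableP _ sG); exact: measurable_funrneg.
  rewrite /funrneg le_max lexx orbT/= ge_max normr_ge0 andbT -normrN; exact: ler_norm.
have WE w : W w = W^\+ w - W^\- w by rewrite -[in LHS](funrposBneg W).
under eq_Rintegral do rewrite WE mulrBr.
by rewrite RintegralB// p0 n0 subrr.
Qed.

End Orthogonality.

(** An averaging identity determines only the value of the integral of a version; finiteness of that
    value forces both its positive and negative parts to have finite integrals, hence
    integrability. *)
Lemma fin_integral_integrable (R : realType) (disp : measure_display)
    (Om : measurableType disp) (mu : {measure set Om -> \bar R}) (D : set Om)
    (f : Om -> \bar R) : measurable D -> measurable_fun D f ->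
  (\int[mu]_(w in D) f w)%E \is a fin_num -> mu.-integrable D f.
Proof.
move=> mD mf; rewrite integralE fin_numB => /andP[fp fn].
apply/integrableP; split => //.
rewrite -[X in integral _ _ X]/(abse \o f) fune_abse ge0_integralD//.
- by rewrite ltey_eq fin_numD fp fn.
- exact: measurable_funepos.
- exact: measurable_funeneg.
Qed.

Lemma integrable_mul_bounded (R : realType) (disp : measure_display)
    (Om : measurableType disp) (mu : {measure set Om -> \bar R}) (M : R)
    (X Z : Om -> R) : measurable_fun setT Z -> {ae mu, forall w, `|Z w| <= M} ->
  mu.-integrable setT (EFin \o X) -> mu.-integrable setT (EFin \o (X \* Z)).
Proof.
move=> mZ ZM iX; apply: (@ae_le_integrable _ _ _ _ _ (fun w => M * `|X w|)).
- apply: measurable_funM => //; exact/measurable_EFinP/(measurable_int mu).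
- apply: filterS ZM => w ZM; rewrite normrM mulrC; exact: ler_wpM2r.
- by apply: integrableZR => //; exact: integrable_norm.
Qed.

(** * Conditional expectations as averaging identities *)

Section ConditionalExpectation.
Context (R : realType) (disp : measure_display) (Om : measurableType disp)
  (P : probability Om R) (G : set (set Om)).
Hypotheses (sG : sigma_algebra setT G) (GM : G `<=` measurable).
Implicit Types (X Y W : Om -> R).

Lemma cond_expectation_integrable X Y D : G D ->
  is_cond_expectation P G X Y -> P.-integrable D (EFin \o X) ->
  P.-integrable D (EFin \o Y).
Proof.
move=> GD [mY _ XY] iX; have mD := GM GD.
apply: fin_integral_integrable => //.
  apply/measurable_EFinP; apply: (measurable_funS measurableT) => //.
  exact: real_measurable_sub mY.
by rewrite XY//; exact: integrable_fin_num.
Qed.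

(** The pull-out property, stated for the difference so that [X * W] and [Y * W] need not be
    separately integrable. *)
Lemma sub_integral_cond_expectation X Y W : is_cond_expectation P G X Y ->
  P.-integrable setT (EFin \o X) -> real_measurable G W ->
  P.-integrable setT (EFin \o (fun w => (X w - Y w) * W w)) ->
  \int[P]_w ((X w - Y w) * W w) = 0.
Proof.
move=> XY iX GW iXYW.
have GT : G setT by case: sG => G0 GC _; rewrite -(setD0 setT); exact: GC.
have iY := cond_expectation_integrable GT XY iX.
apply: (@integral_cond_eq0 _ _ _ P G sG GM (fun w => X w - Y w)) => //.
  exact: (integrableB measurableT iX iY).
move=> A GA; have mA := GM GA.
have iXA := integrableS measurableT mA (@subsetT _ _) iX.
have iYA := integrableS measurableT mA (@subsetT _ _) iY.
rewrite RintegralB//; apply/eqP; rewrite subr_eq0; apply/eqP.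
by case: XY => _ _ XY; rewrite /Rintegral XY.
Qed.

(* [is_cond_expectation] only makes [X] sigma-integrable over [G]; the bound on
   [V] upgrades this to integrability, which is why the integral is not assumed
   finite here. *)
Lemma cond_expectation_le X V (c : R) A : is_cond_expectation P G X V ->
  (forall w, 0 <= X w) -> measurable_fun setT X ->
  {ae P, forall w, V w <= c} -> 0 <= c -> G A ->
  (\int[P]_(w in A) (X w)%:E <= c%:E * P A)%E.
Proof.
move=> XV X0 mX Vc c0 GA.
have [mV [B [GB BT iXB]] XVE] := XV.
have mOm : @measurable _ (g_sigma_algebraType G) = G.
  exact: measurable_g_measurableTypeE.
have GI C D : G C -> G D -> G (C `&` D).
  by rewrite -mOm; exact: measurableI.
(* Made disjoint, the cover cuts [A] into countably many events of [G] on which [X] is integrable.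
   The averaging identity holds on each, and nonnegativity allows summing over the pieces. *)
pose S := seqDU B.
have GS k : G (S k).
  by rewrite -mOm; apply: seqDU_measurable => i; rewrite mOm.
pose D k := A `&` S k.
have GD k : G (D k) by exact: GI.
have mD k : measurable (D k) by exact/GM.
have tD : trivIset setT D by apply: trivIset_setIl; exact: trivIset_seqDU.
have AE : A = \bigcup_k D k.
  by rewrite -setI_bigcupr -seqDU_bigcup_eq BT setIT.
rewrite -integral_cst; last exact: GM.
rewrite AE !ge0_integral_bigcup//; last first.
- by move=> w _; rewrite lee_fin.
- by apply/measurable_EFinP; apply: measurable_funS mX.
apply: lee_nneseries => [k _ _|k _].
  by apply: integral_ge0 => w _; rewrite lee_fin.
have iXD : P.-integrable (D k) (EFin \o X).
  by apply: (integrableS (GM (GB k)) (mD k)) => // w [_ []].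
have iVD := cond_expectation_integrable (GD k) XV iXD.
have icD : P.-integrable (D k) (EFin \o cst c).
  exact: finite_measure_integrable_cst.
rewrite -XVE// -[leLHS]fineK ?integrable_fin_num//.
rewrite -[leRHS]fineK ?(integrable_fin_num (mD k) icD)// lee_fin.
rewrite -!/(Rintegral _ _ _) [leLHS]Rintegral_mkcond [leRHS]Rintegral_mkcond.
apply: ae_le_Rintegral.
- by rewrite -restrict_EFin; exact: (integrable_mkcond _ (mD k)).1.
- by rewrite -restrict_EFin; exact: (integrable_mkcond _ (mD k)).1.
- by apply: filterS Vc => w h; rewrite !patchE; case: ifP.
Qed.

End ConditionalExpectation.

(* For sigma-algebras [G1] and [G2], a pi-system generating their join. *)
Definition pairwise_setI (T : Type) (G1 G2 : set (set T)) : set (set T) :=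
  [set C `&` B | C in G1 & B in G2].

Section ConditionalIndependence.
Context (R : realType) (disp : measure_display) (Om : measurableType disp)
  (P : probability Om R) (G G2 : set (set Om)).
Hypotheses (sG : sigma_algebra setT G) (GM : G `<=` measurable).
Hypotheses (sG2 : sigma_algebra setT G2) (G2M : G2 `<=` measurable).
Variables (I : Om -> bool) (q : Om -> R).
Hypotheses (mI : measurable_fun setT (fun w => (I w)%:R : R)).
Hypotheses (q01 : forall w, 0 <= q w <= 1).
Hypotheses (Iq : is_cond_expectation P G (fun w => (I w)%:R) q).
Hypothesis (indep :
  cond_independent P G (preimage_set_system setT I measurable) G2).

Let IR w : R := (I w)%:R.

Let iI : P.-integrable setT (EFin \o IR).
Proof.
apply: measurable_bounded_integrable => //.
  by rewrite (le_lt_trans (probability_le1 P measurableT))// ltry.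
exists 1; split; first exact: num_real.
move=> M M1 w _ /=; apply: le_trans (ltW M1).
by rewrite /IR; case: (I w); rewrite ?normr1 ?normr0.
Qed.

Let iq : P.-integrable setT (EFin \o q).
Proof.
by apply: cond_expectation_integrable Iq iI => //; case: sG => G0 GC _;
  rewrite -(setD0 setT); exact: GC.
Qed.

Lemma integral_bernoulli_rect C B : G C -> G2 B ->
  \int[P]_(w in C `&` B) (IR w - q w) = 0.
Proof.
move=> GC GB.
have GT : G setT by case: sG => G0 G_C _; rewrite -(setD0 setT); exact: G_C.
pose A := I @^-1` [set true].
have IRE : \1_A = IR :> (Om -> R).
  apply/funext => w; rewrite indicE /IR.
  by have -> : (w \in A) = I w by apply/idP/idP; rewrite inE.
have GA : preimage_set_system setT I measurable A.
  by exists [set true] => //; rewrite setTI.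
have [pA [pB [hA hB hAB]]] := indep GA GB.
have mB := G2M GB; have mC := GM GC.
have iB : P.-integrable setT (EFin \o (\1_B : Om -> R)) by exact: integrable_indic.
have iAB : P.-integrable setT (EFin \o (\1_(A `&` B) : Om -> R)).
  rewrite indicI IRE; apply: (@integrable_mul_bounded _ _ _ _ 1) => //.
  by apply: aeW => w; rewrite indicE; case: (_ \in _); rewrite ?normr1 ?normr0.
rewrite IRE in hA.
have ipA := cond_expectation_integrable GM GT hA iI.
have ipB := cond_expectation_integrable GM GT hB iB.
have ipAB := cond_expectation_integrable GM GT hAB iAB.
have GI1 (X : Om -> R) : measurable_fun setT X -> {ae P, forall w, `|X w| <= 1} ->
    forall Z : Om -> R, P.-integrable setT (EFin \o Z) ->
    P.-integrable setT (EFin \o (Z \* X)).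
  by move=> mX X1 Z iZ; exact: integrable_mul_bounded X1 iZ.
have indic_le1 (D : set Om) : {ae P, forall w, `|\1_D w : R| <= 1}.
  by apply: aeW => w; rewrite indicE; case: (_ \in _); rewrite ?normr1 ?normr0.
have mindic (D : set Om) : measurable D -> measurable_fun setT (\1_D : Om -> R).
  exact: measurable_indic.
have GindicC : real_measurable G (\1_C : Om -> R).
  apply/(real_measurableP _ sG); apply: measurable_indic.
  by rewrite measurable_g_measurableTypeE.
have GM' (X Y : Om -> R) : real_measurable G X -> real_measurable G Y ->
    real_measurable G (X \* Y).
  move=> /(real_measurableP _ sG) mX /(real_measurableP _ sG) mY.
  by apply/(real_measurableP _ sG); exact: measurable_funM.
have [GpA _ _] := hA; have [GpB _ _] := hB; have [Gq _ _] := Iq.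
have mq := real_measurable_sub GM Gq.
have q1 : {ae P, forall w, `|q w| <= 1}.
  by apply: aeW => w; have /andP[q0 ?] := q01 w; rewrite ger0_norm.
have I1 : {ae P, forall w, `|IR w| <= 1}.
  by apply: aeW => w; rewrite /IR; case: (I w); rewrite ?normr1 ?normr0.
have C1 := GI1 _ (mindic _ mC) (indic_le1 C).
have cI := GI1 _ mI I1.
have cq := GI1 _ mq q1.
(* With E denoting E[. | G], 1_A 1_B = T1 + E[1_A] E[1_B],
   E[1_A] E[1_B] = 1_A E[1_B] - T2, 1_A E[1_B] = T3 + q E[1_B] and
   q E[1_B] = q 1_B - T4 on [C], where each T has integral zero; no almost sure
   uniqueness of conditional expectations is needed. *)
pose T1 w := (\1_(A `&` B) w - pA w * pB w) * \1_C w.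
pose T2 w := (IR w - pA w) * (pB w * \1_C w).
pose T3 w := (IR w - q w) * (pB w * \1_C w).
pose T4 w := (\1_B w - pB w) * (q w * \1_C w).
have iT1 : P.-integrable setT (EFin \o T1).
  by apply: C1; exact: (integrableB measurableT iAB ipAB).
have iT2 : P.-integrable setT (EFin \o T2).
  have := C1 _ (integrableB measurableT (cI _ ipB) ipAB).
  by congr (_.-integrable _ _); apply/funext => w; rewrite /T2 /=; congr EFin; ring.
have iT3 : P.-integrable setT (EFin \o T3).
  have := C1 _ (integrableB measurableT (cI _ ipB) (cq _ ipB)).
  by congr (_.-integrable _ _); apply/funext => w; rewrite /T3 /=; congr EFin; ring.
have iT4 : P.-integrable setT (EFin \o T4).
  have := C1 _ (cq _ (integrableB measurableT iB ipB)).
  by congr (_.-integrable _ _); apply/funext => w; rewrite /T4 /=; congr EFin; ring.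
have sub0 := @sub_integral_cond_expectation _ _ _ P G sG GM.
have E1 : \int[P]_w T1 w = 0 by exact: (sub0 _ _ _ hAB iAB GindicC iT1).
have E2 : \int[P]_w T2 w = 0.
  exact: (sub0 _ _ _ hA iI (GM' _ _ GpB GindicC) iT2).
have E3 : \int[P]_w T3 w = 0.
  exact: (sub0 _ _ _ Iq iI (GM' _ _ GpB GindicC) iT3).
have E4 : \int[P]_w T4 w = 0.
  exact: (sub0 _ _ _ hB iB (GM' _ _ Gq GindicC) iT4).
rewrite Rintegral_mkcond (@eq_Rintegral _ _ _ _ _ (fun w => (T1 w - T2 w) + (T3 w - T4 w))).
  rewrite RintegralD//; last 2 first.
  - exact: (integrableB measurableT iT1 iT2).
  - exact: (integrableB measurableT iT3 iT4).
  by rewrite !RintegralB// E1 E2 E3 E4 !subrr addr0.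
move=> w _; rewrite /T1 /T2 /T3 /T4 indicI /= IRE patchE in_setI.
(* Off the set, a restricted function takes the default value [point], which is 0 in [R]. *)
rewrite !indicE; rewrite -![point]/(0 : R); case: (w \in C) => /=; last by ring.
by case: (w \in B) => /=; ring.
Qed.

(** Dynkin's pi-lambda argument: the rectangles are stable under intersection, and since [IR - q] is
    integrable with total integral 0, the events over which its integral vanishes are stable under
    complements and countable disjoint unions. *)
Lemma integral_bernoulli_eq0 D : <<s pairwise_setI G G2 >> D ->
  \int[P]_(w in D) (IR w - q w) = 0.
Proof.
have GT : G setT by case: sG => G0 G_C _; rewrite -(setD0 setT); exact: G_C.
have G2T : G2 setT by case: sG2 => G0 G_C _; rewrite -(setD0 setT); exact: G_C.
have piM : <<s pairwise_setI G G2 >> `<=` measurable.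
  apply: smallest_sub; first exact: sigma_algebra_measurable.
  by move=> _ [C GC [B GB <-]]; apply: measurableI; [exact: GM|exact: G2M].
have iIq : P.-integrable setT (EFin \o (fun w => IR w - q w)).
  exact: (integrableB measurableT iI iq).
have IqT : \int[P]_w (IR w - q w) = 0.
  by rewrite -[setT]setTI; exact: integral_bernoulli_rect.
move: D.
apply: (@dynkin_induction _ (g_sigma_algebraType (pairwise_setI G G2))
  (pairwise_setI G G2) (fun D => \int[P]_(w in D) (IR w - q w) = 0)) => //.
- move=> _ _ [C GC [B GB <-]] [C' GC' [B' GB' <-]].
  exists (C `&` C').
    rewrite -(measurable_g_measurableTypeE sG).
    by apply: measurableI; rewrite measurable_g_measurableTypeE.
  exists (B `&` B'); last by rewrite setIACA.
  rewrite -(measurable_g_measurableTypeE sG2).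
  by apply: measurableI; rewrite measurable_g_measurableTypeE.
- by move=> _ [C GC [B GB <-]]; exact: integral_bernoulli_rect.
- move=> S /piM mS S0.
  have := IqT; rewrite -(setUv S) Rintegral_setU//.
  + by rewrite S0 add0r.
  + exact: measurableC.
  + by rewrite setUv.
  + exact/disj_setPCl.
- move=> F mF tF F0.
  have mF' k : measurable (F k : set Om) by apply: piM; exact: mF.
  rewrite /Rintegral integral_bigcup//.
  + rewrite eseries0// => i _ _.
    rewrite -[LHS]fineK ?[fine _]F0//.
    apply: integrable_fin_num => //.
    exact: (integrableS measurableT (mF' i) (@subsetT _ _) iIq).
  + apply: (integrableS measurableT _ (@subsetT _ _) iIq).
    by apply: bigcup_measurable => k _; exact: mF'.
Qed.

(* q is the conditional expectation of I given the join of [G] and [G2]. *)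
Lemma sub_integral_bernoulli W : real_measurable <<s pairwise_setI G G2 >> W ->
  P.-integrable setT (EFin \o (fun w => (IR w - q w) * W w)) ->
  \int[P]_w ((IR w - q w) * W w) = 0.
Proof.
move=> mW iW.
have sH : sigma_algebra setT <<s pairwise_setI G G2 >>.
  exact: smallest_sigma_algebra.
have HM : <<s pairwise_setI G G2 >> `<=` measurable.
  apply: smallest_sub; first exact: sigma_algebra_measurable.
  by move=> _ [C GC [B GB <-]]; apply: measurableI; [exact: GM|exact: G2M].
apply: (integral_cond_eq0 sH HM _ _ mW iW).
  exact: (integrableB measurableT iI iq).
exact: integral_bernoulli_eq0.
Qed.

End ConditionalIndependence.

(** * Square-integrable random vectors *)

Lemma measurable_fun_invr (R : realType) (disp : measure_display)
    (Om : measurableType disp) (X : Om -> R) :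
  (forall w, 0 < X w) -> measurable_fun setT X ->
  measurable_fun setT (fun w => (X w)^-1).
Proof.
move=> X0 mX; rewrite (_ : (fun w => _) = (fun w => X w `^ (-1))).
  exact: measurableT_comp (measurable_powR _) mX.
by apply/funext => w; rewrite powR_inv1// ltW.
Qed.

Section SquareIntegrable.
Context (R : realType) (disp : measure_display) (Om : measurableType disp)
  (P : probability Om R) (d : nat).
Implicit Types U V : Om -> 'rV[R]_d.

Definition measurable_coords U := forall i, measurable_fun setT (fun w => U w 0 i).

Definition square_integrable U := measurable_coords U /\
  P.-integrable setT (EFin \o (fun w => enorm (U w) ^+ 2)).

Lemma measurable_dotv U V : measurable_coords U -> measurable_coords V ->
  measurable_fun setT (fun w => dotv (U w) (V w)).
Proof.
by move=> mU mV; apply: measurable_sum => i; exact: measurable_funM.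
Qed.

Lemma measurable_enorm_sqr U : measurable_coords U ->
  measurable_fun setT (fun w => enorm (U w) ^+ 2).
Proof.
move=> mU; under eq_fun do rewrite -dotvv; exact: measurable_dotv.
Qed.

Lemma measurable_coordsD U V : measurable_coords U -> measurable_coords V ->
  measurable_coords (fun w => U w + V w).
Proof.
by move=> mU mV i; under eq_fun do rewrite mxE; exact: measurable_funD.
Qed.

Lemma measurable_coordsZ (Z : Om -> R) U : measurable_fun setT Z ->
  measurable_coords U -> measurable_coords (fun w => Z w *: U w).
Proof.
by move=> mZ mU i; under eq_fun do rewrite mxE; exact: measurable_funM.
Qed.

Lemma square_integrable_le U (Y : Om -> R) : measurable_coords U ->
  {ae P, forall w, enorm (U w) ^+ 2 <= Y w} ->
  P.-integrable setT (EFin \o Y) -> square_integrable U.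
Proof.
move=> mU UY iY; split => //; apply: ae_le_integrable iY.
  exact: measurable_enorm_sqr.
by apply: filterS UY => w; rewrite ger0_norm// sqr_ge0.
Qed.

Lemma integrable_cstR (c : R) : P.-integrable setT (EFin \o cst c).
Proof. exact: finite_measure_integrable_cst. Qed.

Lemma square_integrable_cst u : square_integrable (cst u).
Proof. by split => [i|]; [exact: measurable_cst|exact: (integrable_cstR (enorm u ^+ 2))]. Qed.

Lemma integrable_coordM U V i j : square_integrable U -> square_integrable V ->
  P.-integrable setT (EFin \o (fun w => U w 0 i * V w 0 j)).
Proof.
move=> [mU iU] [mV iV].
apply: (@ae_le_integrable _ _ _ _ _ (fun w => enorm (U w) ^+ 2 + enorm (V w) ^+ 2)).
- exact: measurable_funM.
- apply: aeW => w; rewrite normrM.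
  have coord_le (u : 'rV[R]_d) k : `|u 0 k| ^+ 2 <= enorm u ^+ 2.
    rewrite real_normK ?num_real// enorm_sqr (bigD1 k)//= lerDl.
    by rewrite sumr_ge0// => l _; rewrite sqr_ge0.
  have := coord_le (U w) i; have := coord_le (V w) j.
  have := normr_ge0 (U w 0 i); have := normr_ge0 (V w 0 j).
  move: (`|U w 0 i|) (`|V w 0 j|) => a b b0 a0.
  have := sqr_ge0 (a - b); rewrite !expr2; nra.
- exact: (integrableD measurableT iU iV).
Qed.

Lemma integrable_dotv U V : square_integrable U -> square_integrable V ->
  P.-integrable setT (EFin \o (fun w => dotv (U w) (V w))).
Proof.
by move=> sU sV; apply: integrable_sumR => // i; exact: integrable_coordM.
Qed.

Lemma square_integrableD U V : square_integrable U -> square_integrable V ->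
  square_integrable (fun w => U w + V w).
Proof.
move=> [mU iU] [mV iV].
apply: (@square_integrable_le _
  (fun w => 2 * enorm (U w) ^+ 2 + 2 * enorm (V w) ^+ 2)).
- exact: measurable_coordsD.
- by apply: aeW => w; exact: enorm_sqrD_le.
- by apply: integrableDR => //; exact: integrableZR.
Qed.

Lemma square_integrableZ (k : R) U : square_integrable U ->
  square_integrable (fun w => k *: U w).
Proof.
move=> [mU iU]; split.
  by apply: (@measurable_coordsZ (cst k)) => //; exact: measurable_cst.
by under eq_fun do rewrite enorm_sqrZ; exact: integrableZR.
Qed.

Lemma square_integrable_sum (I : Type) (r : seq I) (U : I -> Om -> 'rV[R]_d) :
  (forall i, square_integrable (U i)) ->
  square_integrable (fun w => \sum_(i <- r) U i w).
Proof.
move=> sU; elim: r => [|i r ih].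
  by under eq_fun do rewrite big_nil; exact: square_integrable_cst.
by under eq_fun do rewrite big_cons; exact: square_integrableD.
Qed.

End SquareIntegrable.

(** * Lipschitz gradients evaluated at random points *)

Lemma lipschitz_sqr_continuous (R : realType) (V : normedModType R)
    (phi : V -> R) (K : R) : 0 <= K ->
  (forall x y, (phi x - phi y) ^+ 2 <= K * `|x - y| ^+ 2) -> continuous phi.
Proof.
move=> K0 lip x; apply/cvgrPdist_lt => e e0.
have K1 : 0 < K + 1 by rewrite ltr_wpDl.
have r0 : 0 < e ^+ 2 / (K + 1) by rewrite divr_gt0// exprn_gt0.
have : \forall y \near x, `|x - y| < Num.sqrt (e ^+ 2 / (K + 1)).
  by apply: cvgr_dist_lt => //; rewrite sqrtr_gt0.
apply: filterS => y xy.
rewrite -(ltr_pXn2r (n:=2))// ?nnegrE ?ltW// real_normK ?num_real//.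
apply: le_lt_trans (lip _ _) _.
apply: (@le_lt_trans _ _ (K * (e ^+ 2 / (K + 1)))).
  rewrite ler_wpM2l// -(sqr_sqrtr (ltW r0)).
  by rewrite lerXn2r ?nnegrE ?sqrtr_ge0// ltW.
rewrite mulrA ltr_pdivrMr// mulrC ltr_pM2l ?exprn_gt0//.
by rewrite ltrDl.
Qed.

Lemma norm_coord_le (R : realType) (m n : nat) (A : 'M[R]_(m, n)) i j :
  `|A i j| <= `|A|.
Proof.
rewrite [leRHS]mx_normrE.
exact: (le_bigmax_cond _ (fun ij => `|A ij.1 ij.2|) (j := (i, j))).
Qed.

Section LipschitzGradient.
Context (R : realType) (d : nat) (f : 'rV[R]_d -> R) (L : R).
Hypothesis lip : forall z w, enorm (gradient f z - gradient f w) ^+ 2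
  <= L ^+ 2 * enorm (z - w) ^+ 2.

(** The factor [d] compares norms: the squared Euclidean norm is at most [d] times the square of the
    sup norm, which defines the topology. *)
Lemma continuous_gradient i : continuous (fun z => gradient f z 0 i).
Proof.
apply: (@lipschitz_sqr_continuous _ _ _ (L ^+ 2 * d%:R)).
  by rewrite mulr_ge0// sqr_ge0.
move=> z y.
have h1 : (gradient f z 0 i - gradient f y 0 i) ^+ 2
    <= enorm (gradient f z - gradient f y) ^+ 2.
  rewrite enorm_sqr (bigD1 i)//= !mxE lerDl.
  by rewrite sumr_ge0// => l _; rewrite sqr_ge0.
apply: le_trans h1 _; apply: le_trans (lip _ _) _.
rewrite -mulrA ler_wpM2l ?sqr_ge0// enorm_sqr.
rewrite [leRHS]mulr_natl -[X in _ *+ X]card_ord -sumr_const.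
apply: ler_sum => j _; rewrite -[leLHS]real_normK ?num_real//.
by rewrite lerXn2r ?nnegrE//; exact: norm_coord_le.
Qed.

Context (disp : measure_display) (Om : measurableType disp)
  (P : probability Om R).

Lemma measurable_gradient (X : Om -> 'rV[R]_d) : measurable_coords X ->
  measurable_coords (fun w => gradient f (X w)).
Proof.
move=> mX i; apply: (measurable_continuous_rV mX (phi := fun z => gradient f z 0 i)).
exact: continuous_gradient.
Qed.

Lemma square_integrable_gradient (X : Om -> 'rV[R]_d) :
  square_integrable P X -> square_integrable P (fun w => gradient f (X w)).
Proof.
move=> [mX iX]; apply: (@square_integrable_le _ _ _ _ _ _
  (fun w => 2 * L ^+ 2 * enorm (X w) ^+ 2 + 2 * enorm (gradient f 0) ^+ 2)).
- exact: measurable_gradient.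
- apply: aeW => w.
  have := enorm_sqrD_le (gradient f (X w) - gradient f 0) (gradient f 0).
  by rewrite subrK; have := lip (X w) 0; rewrite subr0; nra.
- apply: integrableDR => //; first exact: integrableZR.
  exact: (integrable_cstR _ (2 * enorm (gradient f 0) ^+ 2)).
Qed.

End LipschitzGradient.

Lemma real_measurable_mono (R : realType) (Om : Type) (G H : set (set Om))
    (X : Om -> R) : G `<=` H -> real_measurable G X -> real_measurable H X.
Proof. by move=> GH GX; exact: subset_trans GH. Qed.

Lemma real_measurableM (R : realType) (Om : pointedType) (G : set (set Om))
    (X Y : Om -> R) : sigma_algebra setT G ->
  real_measurable G X -> real_measurable G Y ->
  real_measurable G (fun w => X w * Y w).
Proof.
move=> sG /(real_measurableP _ sG) mX /(real_measurableP _ sG) mY.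
by apply/(real_measurableP _ sG); exact: measurable_funM.
Qed.

Lemma real_measurable_dotv (R : realType) (Om : pointedType) (d : nat)
    (G : set (set Om)) (U V : Om -> 'rV[R]_d) : sigma_algebra setT G ->
  (forall i, real_measurable G (fun w => U w 0 i)) ->
  (forall i, real_measurable G (fun w => V w 0 i)) ->
  real_measurable G (fun w => dotv (U w) (V w)).
Proof.
move=> sG mU mV; apply/(real_measurableP _ sG); apply: measurable_dotv => i.
  by apply/(real_measurableP _ sG); exact: mU.
by apply/(real_measurableP _ sG); exact: mV.
Qed.

(** * One client, one iteration, and the theorem *)

Section Client.
Context (R : realType) (disp : measure_display) (Om : measurableType disp)
  (P : probability Om R) (d : nat) (G : set (set Om)).
Hypotheses (sG : sigma_algebra setT G) (GM : G `<=` measurable).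
Variables (Fn : 'rV[R]_d -> R) (L sigma M : R) (q : Om -> R) (I : Om -> bool)
  (x gx : Om -> 'rV[R]_d).
Hypothesis lip : forall z w, enorm (gradient Fn z - gradient Fn w) ^+ 2
  <= L ^+ 2 * enorm (z - w) ^+ 2.
Hypotheses (q01 : forall w, 0 < q w <= 1) (qM : {ae P, forall w, (q w)^-1 <= M}).
Hypotheses (Gq : real_measurable G q) (mI : bool_measurable measurable I).
Hypothesis mg : rV_measurable measurable gx.
Hypothesis Gx : forall i, real_measurable G (fun w => x w 0 i).
Hypothesis sampling : flexfl_sampling P G Fn sigma q I x gx.
Hypothesis sx : square_integrable P x.

Let m w := gradient Fn (x w).
Let dev w := gx w - m w.
Let IR w : R := (I w)%:R.

Let q0 w : 0 < q w. Proof. by case/andP: (q01 w). Qed.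

Let GT : G setT.
Proof. by case: sG => G0 GC _; rewrite -(setD0 setT); exact: GC. Qed.

Let sm : square_integrable P m.
Proof. exact: square_integrable_gradient sx. Qed.

Let Gm i : real_measurable G (fun w => m w 0 i).
Proof.
apply/(real_measurableP _ sG).
apply: (measurable_gradient lip (X := x : g_sigma_algebraType G -> _)) => j.
by apply/(real_measurableP _ sG); exact: Gx.
Qed.

Let GVq : real_measurable G (fun w => (q w)^-1).
Proof.
apply/(real_measurableP _ sG); apply: measurable_fun_invr => //.
exact/(real_measurableP _ sG).
Qed.

Let mVq : measurable_fun setT (fun w => (q w)^-1).
Proof. exact: real_measurable_sub GM GVq. Qed.

Let normVq : {ae P, forall w, `|(q w)^-1| <= M}.
Proof. by apply: filterS qM => w; rewrite ger0_norm// invr_ge0 ltW. Qed.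

Let mgx : measurable_coords gx.
Proof. by move=> i _ Y mY; apply: (rV_measurableP (i := i) mg); exists Y. Qed.

Let mIR : measurable_fun setT IR.
Proof.
by move=> _ Y mY; apply: mI; exists [set c : bool | Y c%:R].
Qed.

Let mdev : measurable_coords dev.
Proof.
move=> i; rewrite (_ : (fun w => _) = (fun w => gx w 0 i - m w 0 i)).
  by apply: measurable_funB => //; case: sm => + _; exact.
by apply/funext => w; rewrite !mxE.
Qed.

(** Needed on every event of [G], not only on the whole space: the deviation is later weighted by
    the [G]-measurable [1/q]. *)
Let dev_le A : G A -> (\int[P]_(w in A) (enorm (dev w) ^+ 2)%:E <= (sigma ^+ 2)%:E * P A)%E.
Proof.
have [V hV Vs] := sampling_variance sampling.
apply: (cond_expectation_le sG GM hV) => //.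
- by move=> w; rewrite sqr_ge0.
- exact: measurable_enorm_sqr.
- by rewrite sqr_ge0.
Qed.

Let sdev : square_integrable P dev.
Proof.
split => //; apply/integrableP; split.
  by apply/measurable_EFinP; exact: measurable_enorm_sqr.
under eq_integral do rewrite /= ger0_norm ?sqr_ge0//.
apply: le_lt_trans (dev_le GT) _.
by rewrite probability_setT mule1 ltry.
Qed.

Let sgx : square_integrable P gx.
Proof.
rewrite (_ : gx = fun w => dev w + m w); first exact: square_integrableD.
by apply/funext => w; rewrite subrK.
Qed.

Let igx i : P.-integrable setT (EFin \o (fun w => gx w 0 i)).
Proof.
have := integrable_coordM i i sgx (square_integrable_cst P (const_mx 1)).
by congr (_.-integrable _ _); apply/funext => w /=; rewrite mxE mulr1.
Qed.

Let integral_dev i (Z : Om -> 'rV[R]_d) : (forall i, real_measurable G (fun w => Z w 0 i)) ->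
  square_integrable P Z -> \int[P]_w (dev w 0 i * Z w 0 i) = 0.
Proof.
move=> GZ sZ.
have -> : \int[P]_w (dev w 0 i * Z w 0 i) =
    \int[P]_w ((gx w 0 i - m w 0 i) * Z w 0 i).
  by apply: eq_Rintegral => w _; rewrite !mxE.
apply: (sub_integral_cond_expectation sG GM (sampling_mean sampling i)) => //.
have := integrable_coordM i i sdev sZ.
by congr (_.-integrable _ _); apply/funext => w /=; rewrite !mxE.
Qed.

Lemma integral_dotv_dev (Z : Om -> 'rV[R]_d) :
  (forall i, real_measurable G (fun w => Z w 0 i)) -> square_integrable P Z ->
  \int[P]_w dotv (dev w) (Z w) = 0.
Proof.
move=> GZ sZ; rewrite Rintegral_sum// => [|i]; last exact: integrable_coordM.
by rewrite big1// => i _; exact: integral_dev.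
Qed.

(** The past joined with the drawn gradient: every factor that multiplies the coin in the update is
    [H]-measurable. *)
Let H := <<s pairwise_setI G (sigma_rV gx) >>.
Let sH : sigma_algebra setT H. Proof. exact: smallest_sigma_algebra. Qed.

Let sg2 : sigma_algebra setT (sigma_rV gx).
Proof. exact: smallest_sigma_algebra. Qed.

Let GH : G `<=` H.
Proof.
move=> A GA; apply: sub_sigma_algebra; exists A => //; exists setT.
  by case: sg2 => g0 gC _; rewrite -(setD0 setT); exact: gC.
by rewrite setIT.
Qed.

Let gH i : real_measurable H (fun w => gx w 0 i).
Proof.
apply: (real_measurable_mono (G := sigma_rV gx)).
  by move=> A gA; apply: sub_sigma_algebra; exists setT => //; exists A; rewrite ?setTI.
exact: (@rV_measurableP _ _ _ (sigma_rV gx)).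
Qed.

Lemma integral_bernoulliM (W : Om -> R) : real_measurable H W ->
  P.-integrable setT (EFin \o W) ->
  P.-integrable setT (EFin \o (fun w => IR w * W w)) /\
  \int[P]_w (IR w * W w) = \int[P]_w (q w * W w).
Proof.
move=> HW iW.
have IR1 : {ae P, forall w, `|IR w| <= 1}.
  by apply: aeW => w; rewrite /IR; case: (I w); rewrite ?normr1 ?normr0.
have q1 : {ae P, forall w, `|q w| <= 1}.
  by apply: aeW => w; rewrite gtr0_norm//; case/andP: (q01 w).
have iIW : P.-integrable setT (EFin \o (fun w => IR w * W w)).
  have := integrable_mul_bounded mIR IR1 iW.
  by congr (_.-integrable _ _); apply/funext => w /=; rewrite mulrC.
have iqW : P.-integrable setT (EFin \o (fun w => q w * W w)).
  have := integrable_mul_bounded (real_measurable_sub GM Gq) q1 iW.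
  by congr (_.-integrable _ _); apply/funext => w /=; rewrite mulrC.
split => //; apply/eqP; rewrite -subr_eq0 -RintegralB//; apply/eqP.
under eq_Rintegral do rewrite -mulrBl.
apply: (sub_integral_bernoulli sG GM sg2) => //.
- by move=> w; case/andP: (q01 w) => /ltW -> ->.
- exact: sampling_bernoulli sampling.
- exact: sampling_independent sampling.
- have := integrableBR measurableT iIW iqW.
  by congr (_.-integrable _ _); apply/funext => w /=; rewrite mulrBl.
Qed.

(** Two averagings: given [H] the coin becomes [q] and cancels [1/q]; then [gx] becomes its mean,
    because [dev] is orthogonal to the [G]-measurable [Z]. *)
Lemma client_update_mean (Z : Om -> 'rV[R]_d) :
  (forall i, real_measurable G (fun w => Z w 0 i)) -> square_integrable P Z ->
  \int[P]_w dotv (Z w) ((IR w / q w) *: gx w) = \int[P]_w dotv (Z w) (m w).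
Proof.
move=> GZ sZ; pose W w := dotv (Z w) (gx w) * (q w)^-1.
have iZg := integrable_dotv sZ sgx.
have iW : P.-integrable setT (EFin \o W).
  exact: (integrable_mul_bounded mVq normVq iZg).
have HW : real_measurable H W.
  apply: real_measurableM => //; last exact: real_measurable_mono GVq.
  by apply: real_measurable_dotv => // i; exact: real_measurable_mono (GZ i).
have [_ E] := integral_bernoulliM HW iW.
transitivity (\int[P]_w (IR w * W w)).
  by apply: eq_Rintegral => w _; rewrite dotvZr /W; ring.
rewrite E; transitivity (\int[P]_w dotv (Z w) (gx w)).
  by apply: eq_Rintegral => w _; rewrite /W mulrC mulfVK// gt_eqF.
apply/eqP; rewrite -subr_eq0 -RintegralB//; last exact: integrable_dotv.
rewrite -[X in _ == X](integral_dotv_dev GZ sZ); apply/eqP; apply: eq_Rintegral => w _.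
by rewrite (dotvC (dev w)) /dev -(scaleN1r (m w)) dotvDr dotvZr; ring.
Qed.

(** As I^2 = I, averaging the coin leaves E[|gx|^2 / q]. Expanding [gx = dev + m], the cross term
    vanishes because [m / q] is [G]-measurable, and the variance term is bounded under the weight
    [1/q]. *)
Lemma client_update_second_moment :
  square_integrable P (fun w => (IR w / q w) *: gx w) /\
  \int[P]_w enorm ((IR w / q w) *: gx w) ^+ 2 <=
  \int[P]_w ((sigma ^+ 2 + enorm (m w) ^+ 2) / q w).
Proof.
pose W w := enorm (gx w) ^+ 2 * ((q w)^-1 * (q w)^-1).
have iVq (X : Om -> R) : P.-integrable setT (EFin \o X) ->
    P.-integrable setT (EFin \o (fun w => X w * (q w)^-1)).
  exact: (integrable_mul_bounded mVq normVq).
have [_ ig] := sgx.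
have iW : P.-integrable setT (EFin \o W).
  have := iVq _ (iVq _ ig).
  by congr (_.-integrable _ _); apply/funext => w; rewrite /W /= mulrA.
have HVq : real_measurable H (fun w => (q w)^-1) by exact: real_measurable_mono GVq.
have HW : real_measurable H W.
  apply: real_measurableM => //; last exact: real_measurableM.
  under eq_fun do rewrite -dotvv; exact: real_measurable_dotv.
have [iIW E] := integral_bernoulliM HW iW.
have WE w : enorm ((IR w / q w) *: gx w) ^+ 2 = IR w * W w.
  rewrite enorm_sqrZ /W /IR.
  by case: (I w); rewrite ?mul0r ?expr0n ?mul0r// !mul1r; ring.
split.
  split; last by under eq_fun do rewrite WE.
  by apply: measurable_coordsZ => //; exact: measurable_funM.
under eq_Rintegral do rewrite WE.
rewrite E.
have [_ im] := sm; have [_ idev] := sdev.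
(* The integral of [h] over each event of [G] is at most 0 by [dev_le], so it stays nonpositive
   under the nonnegative weight [1/q]. *)
pose h w := enorm (dev w) ^+ 2 - sigma ^+ 2.
have ih : P.-integrable setT (EFin \o h).
  by apply: integrableBR => //; exact: integrable_cstR.
have [mm _] := sm.
have sVqm : square_integrable P (fun w => (q w)^-1 *: m w).
  apply: (@square_integrable_le _ _ _ _ _ _ (fun w => (enorm (m w) ^+ 2 * (M * M)))).
  - exact: measurable_coordsZ.
  - apply: filterS normVq => w; rewrite enorm_sqrZ ger0_norm ?invr_ge0 ?(ltW (q0 w))// => qM'.
    rewrite mulrC ler_wpM2l ?sqr_ge0// expr2.
    by rewrite ler_pM// invr_ge0 (ltW (q0 w)).
  - have := integrableZR (M * M) measurableT im.
    by congr (_.-integrable _ _); apply/funext => w /=; rewrite mulrC.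
have GVqm i : real_measurable G (fun w => ((q w)^-1 *: m w) 0 i).
  by under eq_fun do rewrite mxE; exact: real_measurableM.
have iA := iVq _ ih.
have iB := integrableZR 2 measurableT (integrable_dotv sdev sVqm).
have iC : P.-integrable setT (EFin \o (fun w => (sigma ^+ 2 + enorm (m w) ^+ 2) / q w)).
  by apply: iVq; apply: integrableDR => //; exact: integrable_cstR.
have -> : \int[P]_w (q w * W w) = \int[P]_w (h w * (q w)^-1 +
    2 * dotv (dev w) ((q w)^-1 *: m w) + (sigma ^+ 2 + enorm (m w) ^+ 2) / q w).
  apply: eq_Rintegral => w _.
  have -> : W w = (enorm (dev w) ^+ 2 + 2 * dotv (dev w) (m w) + enorm (m w) ^+ 2)
      * ((q w)^-1 * (q w)^-1) by rewrite -enorm_sqrD subrK.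
  rewrite dotvZr /h; have := lt0r_neq0 (q0 w); move=> q0'; field.
  exact: q0'.
rewrite RintegralD//; last exact: integrableDR.
rewrite RintegralD// RintegralZl//; last exact: integrable_dotv.
rewrite integral_dotv_dev// mulr0 addr0 gerDr.
apply: (integral_cond_le0 sG GM ih) => //; last by move=> w; rewrite invr_ge0 ltW.
move=> A GA; have mA := GM GA.
have iSA X : P.-integrable setT (EFin \o X) -> P.-integrable A (EFin \o X).
  exact: (integrableS measurableT mA (@subsetT _ _)).
rewrite RintegralB//; [|exact: iSA|exact: iSA (integrable_cstR _ _)].
rewrite subr_le0 -lee_fin /Rintegral !fineK; last 2 first.
- by apply: integrable_fin_num => //; exact: iSA (integrable_cstR P (sigma ^+ 2)).
- by apply: integrable_fin_num => //; exact: iSA.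
by rewrite integral_cst//; exact: dev_le.
Qed.

End Client.

(** * Expected decrease of the objective in one iteration *)

Section Iteration.
Context (R : realType) (disp : measure_display) (Om : measurableType disp)
  (P : probability Om R) (N d : nat).
Hypothesis N0 : (0 < N)%N.
Variable F : 'I_N -> 'rV[R]_d -> R.
Hypothesis dF : forall n x, differentiable (F n) x.
Let f := average_objective F.
Variables (fstar L sigma eps eta p : R).
Hypotheses (fmin : forall z, fstar <= f z) (L0 : 0 < L).
Hypothesis lip : forall n z w, enorm (gradient (F n) z - gradient (F n) w) ^+ 2
  <= L ^+ 2 * enorm (z - w) ^+ 2.

Let lipf : forall z w, enorm (gradient f z - gradient f w) ^+ 2
  <= L ^+ 2 * enorm (z - w) ^+ 2.
Proof. exact: average_gradient_lipschitz. Qed.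

Let descent z w :
  f w <= f z + dotv (gradient f z) (w - z) + L / 2 * enorm (w - z) ^+ 2.
Proof. by apply: descent_lemma => // u; exact: differentiable_average. Qed.

(** [f] lies between its minimum and the quadratic majorant that the descent lemma gives at the
    origin. *)
Lemma integrable_objective (Y : Om -> 'rV[R]_d) : square_integrable P Y ->
  P.-integrable setT (EFin \o (fun w => f (Y w))).
Proof.
move=> [mY iY].
pose C := `|fstar| + `|f 0| + enorm (gradient f 0) ^+ 2 / 2.
apply: (@ae_le_integrable _ _ _ _ _ (fun w => C + (1 + L) / 2 * enorm (Y w) ^+ 2)).
- apply: (measurable_continuous_rV mY (phi := f)) => z.
  exact/differentiable_continuous/differentiable_average.
- apply: aeW => w.
  have := descent 0 (Y w); rewrite subr0 => h1.
  have := dotv_amgm (gradient f 0) (Y w) ltr01; rewrite invr1 => h2.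
  have := fmin (Y w); have := ler_norm (f 0); have := ler_norm (- fstar).
  have := normr_ge0 fstar; have := normr_ge0 (f 0); rewrite normrN.
  have := sqr_ge0 (enorm (gradient f 0)); have := sqr_ge0 (enorm (Y w)).
  rewrite ler_norml /C; move: (enorm (Y w) ^+ 2) h1 h2 => a h1 h2.
  move=> a0 ? ? ? ? ? ?; have := mulr_ge0 (ltW L0) a0 => ?.
  apply/andP; split; lra.
- by apply: integrableDR => //; [exact: integrable_cstR|exact: integrableZR].
Qed.

Variables (G : set (set Om)) (q : 'I_N -> Om -> R) (I : 'I_N -> Om -> bool)
  (gx e : 'I_N -> Om -> 'rV[R]_d) (x r y : Om -> 'rV[R]_d).
Hypotheses (sG : sigma_algebra setT G) (GM : G `<=` measurable).
Hypothesis het : forall n z, enorm (gradient (F n) z - gradient f z) ^+ 2 <= eps ^+ 2.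
Hypothesis eta0 : 0 < eta.
Hypothesis q01 : forall n w, 0 < q n w <= 1.
Hypothesis qp : {ae P, forall w, N%:R^-1 * \sum_(n < N) (q n w)^-1 <= p}.
Hypothesis etap : eta * L * p <= 4^-1.
Hypothesis Gq : forall n, real_measurable G (q n).
Hypothesis mI : forall n, bool_measurable measurable (I n).
Hypothesis mg : forall n, rV_measurable measurable (gx n).
Hypothesis Gx : rV_measurable G x.
Hypothesis Gr : rV_measurable G r.
Hypothesis Ge : forall n, rV_measurable G (e n).
Hypothesis sampling : forall n, flexfl_sampling P G (F n) sigma (q n) (I n) x (gx n).
Hypothesis yE : forall w, y w = x w + r w + N%:R^-1 *: \sum_n e n w.
Hypotheses (sr : square_integrable P r) (se : forall n, square_integrable P (e n)).
Hypothesis sy : square_integrable P y.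

Let sx : square_integrable P x.
Proof.
rewrite (_ : x = fun w => y w + (-1) *: (r w + N%:R^-1 *: \sum_n e n w)).
  apply: square_integrableD => //; apply: square_integrableZ.
  apply: square_integrableD => //; apply: square_integrableZ.
  exact: square_integrable_sum.
by apply/funext => w; rewrite yE scaleN1r -(addrA (x w)) addrK.
Qed.

Let Gcoord (X : Om -> 'rV[R]_d) : rV_measurable G X ->
  measurable_coords (X : g_sigma_algebraType G -> _).
Proof.
by move=> GX i; apply/(real_measurableP _ sG); exact: rV_measurableP.
Qed.

Let Ggradf_y i : real_measurable G (fun w => gradient f (y w) 0 i).
Proof.
apply/(real_measurableP _ sG).
apply: (measurable_gradient lipf (X := y : g_sigma_algebraType G -> _)).
rewrite (_ : y = fun w => x w + r w + N%:R^-1 *: \sum_n e n w); last exact/funext.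
apply: measurable_coordsD; first by apply: measurable_coordsD; exact: Gcoord.
apply: measurable_coordsZ; first exact: measurable_cst.
move=> j; under eq_fun do rewrite summxE.
by apply: measurable_sum => n; exact: Gcoord.
Qed.

Let qM n : {ae P, forall w, (q n w)^-1 <= N%:R * p}.
Proof.
apply: filterS qp => w; rewrite ler_pdivrMl ?ltr0n//; apply: le_trans.
rewrite (bigD1 n)//= lerDl sumr_ge0// => k _.
by rewrite invr_ge0 ltW//; case/andP: (q01 k w).
Qed.

Let U n w := ((I n w)%:R / q n w) *: gx n w.
Let m n w := gradient (F n) (x w).

Let sm n : square_integrable P (m n).
Proof. exact: square_integrable_gradient sx. Qed.

Let mVq n : measurable_fun setT (fun w => (q n w)^-1).
Proof.
apply: measurable_fun_invr => [w|]; first by case/andP: (q01 n w).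
exact: real_measurable_sub GM (@Gq n).
Qed.

Let normVq n : {ae P, forall w, `|(q n w)^-1| <= N%:R * p}.
Proof.
apply: filterS (qM n) => w; rewrite ger0_norm// invr_ge0 ltW//.
by case/andP: (q01 n w).
Qed.

Lemma integrable_inv_probability n :
  P.-integrable setT (EFin \o (fun w => (q n w)^-1)).
Proof.
by apply: ae_le_integrable (normVq n) _ => //; exact: integrable_cstR.
Qed.

Let B n w := (sigma ^+ 2 + enorm (m n w) ^+ 2) / q n w.

Let iB n : P.-integrable setT (EFin \o B n).
Proof.
apply: (integrable_mul_bounded (mVq n) (normVq n)).
by apply: integrableDR => //; [exact: integrable_cstR|exact: (sm n).2].
Qed.

Let update n : square_integrable P (U n) /\
  \int[P]_w enorm (U n w) ^+ 2 <= \int[P]_w B n w.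
Proof.
apply: (client_update_second_moment sG GM (@lip n) (q01 n) (qM n)) => //.
by move=> i; exact: rV_measurableP.
Qed.

Let update_mean n : \int[P]_w dotv (gradient f (y w)) (U n w) =
  \int[P]_w dotv (gradient f (y w)) (m n w).
Proof.
apply: (client_update_mean sG GM (@lip n) (q01 n) (qM n) (gx := gx n)) => //.
exact: square_integrable_gradient sy.
Qed.

(** The three upper bounds compared in [flexfl_iteration] all have this shape. *)
Let expand (X : Om -> R) (A C : 'I_N -> Om -> R) (a c : R) :
  P.-integrable setT (EFin \o X) ->
  (forall n, P.-integrable setT (EFin \o A n)) ->
  (forall n, P.-integrable setT (EFin \o C n)) ->
  P.-integrable setT
    (EFin \o (fun w => X w + a * \sum_n A n w + c * \sum_n C n w)) /\
  \int[P]_w (X w + a * \sum_n A n w + c * \sum_n C n w) =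
  \int[P]_w X w + a * (\sum_n \int[P]_w A n w) + c * (\sum_n \int[P]_w C n w).
Proof.
move=> iX iA iC.
have iSA := integrable_sumR (index_enum 'I_N) measurableT iA.
have iSC := integrable_sumR (index_enum 'I_N) measurableT iC.
have iaA := integrableZR a measurableT iSA.
have icC := integrableZR c measurableT iSC.
have iXA := integrableDR measurableT iX iaA.
split; first exact: (integrableDR measurableT iXA icC).
rewrite (RintegralD measurableT iXA icC) (RintegralD measurableT iX iaA).
by rewrite (RintegralZl a measurableT iSA) (RintegralZl c measurableT iSC) !Rintegral_sum.
Qed.

Let pathwise w : N%:R^-1 * \sum_(n < N) (q n w)^-1 <= p ->
  f (y w) + (- eta / N%:R) * \sum_n dotv (gradient f (y w)) (m n w)
    + (L * eta ^+ 2 / 2 / N%:R) * \sum_n B n w <=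
  f (y w) - eta / 4 * enorm (gradient f (x w)) ^+ 2
    + eta * L ^+ 2 * enorm (r w) ^+ 2
    + (eta * L ^+ 2 / N%:R) * \sum_n enorm (e n w) ^+ 2
    + (L * eta ^+ 2 * (eps ^+ 2 + sigma ^+ 2) / N%:R) * \sum_n (q n w)^-1.
Proof.
set Q := N%:R^-1 * _ => Qp.
have NN0 : (0 : R) < N%:R by rewrite ltr0n.
set a := gradient f (y w); set b := gradient f (x w).
have -> : - eta / N%:R * \sum_n dotv a (m n w) = - eta * dotv a b.
  by rewrite /b gradient_average// dotvZr dotv_sumr mulrA.
have Q0 : 0 <= Q.
  rewrite mulr_ge0 ?invr_ge0// sumr_ge0// => k _.
  by rewrite invr_ge0 ltW//; case/andP: (q01 k w).
have hab : enorm (a - b) ^+ 2 <= L ^+ 2 *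
    (2 * enorm (r w) ^+ 2 + 2 * (N%:R^-1 * \sum_n enorm (e n w) ^+ 2)).
  apply: le_trans (lipf _ _) _; rewrite ler_wpM2l ?sqr_ge0//.
  rewrite yE -(addrA (x w)) addrAC subrr add0r.
  apply: le_trans (enorm_sqrD_le _ _) _.
  by rewrite lerD2l ler_wpM2l//; exact: enorm_mean_le.
(* The factors 2 come from splitting each client gradient into its deviation from [b], bounded by
   [eps], and [b] itself. *)
have hB : N%:R^-1 * \sum_n B n w <=
    (sigma ^+ 2 + 2 * eps ^+ 2 + 2 * enorm b ^+ 2) * Q.
  rewrite mulrCA ler_wpM2l ?invr_ge0// mulr_sumr; apply: ler_sum => n _.
  rewrite ler_wpM2r ?invr_ge0 ?(ltW (andP (q01 n w)).1)// -addrA lerD2l.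
  have := enorm_sqrD_le (m n w - b) b; rewrite subrK.
  have := het n (x w); rewrite -/b /m; lra.
(* Polarisation supplies the decrease eta/2 |b|^2 and charges only eta/2 |a - b|^2, which becomes
   the residual terms. *)
have dotE : dotv a b = (enorm a ^+ 2 + enorm b ^+ 2 - enorm (a - b) ^+ 2) / 2.
  have := enorm_sqrD a (- b); rewrite enorm_sqrN -(scaleN1r b) dotvZr; lra.
have a0 := sqr_ge0 (enorm a); have b0 := sqr_ge0 (enorm b).
have r0 := sqr_ge0 (enorm (r w)).
have s0 := sqr_ge0 sigma.
have hpQ : eta * L * Q <= 4^-1.
  by apply: le_trans etap; rewrite ler_wpM2l// mulr_ge0// ltW.
rewrite dotE.
have -> : L * eta ^+ 2 / 2 / N%:R * \sum_n B n w =
  L * eta ^+ 2 / 2 * (N%:R^-1 * \sum_n B n w) by rewrite -!mulrA.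
have -> : eta * L ^+ 2 / N%:R * \sum_n enorm (e n w) ^+ 2 =
  eta * L ^+ 2 * (N%:R^-1 * \sum_n enorm (e n w) ^+ 2) by rewrite -!mulrA.
have -> : L * eta ^+ 2 * (eps ^+ 2 + sigma ^+ 2) / N%:R * \sum_n (q n w)^-1 =
  L * eta ^+ 2 * (eps ^+ 2 + sigma ^+ 2) * Q by rewrite -!mulrA.
move: hab hB; move: (N%:R^-1 * _) => Se; move: (N%:R^-1 * _) => SB hab hB.
have c0 : 0 <= L * eta ^+ 2 / 2.
  by rewrite divr_ge0// mulr_ge0 ?sqr_ge0// ltW.
(* Balance of constants: [h3] bounds the part of the second moment in |b|^2 by eta/4 |b|^2, half of
   the available decrease; [h4] is the slack that raises sigma^2 / 2 to sigma^2; [h5] discards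
   |a|^2. *)
have h1 := ler_wpM2l c0 hB.
have h2 := ler_wpM2l (ltW eta0) hab.
have h3 := ler_wpM2l (mulr_ge0 (ltW eta0) b0) hpQ.
have h4 := mulr_ge0 (mulr_ge0 (mulr_ge0 (ltW L0) (sqr_ge0 eta)) s0) Q0.
have h5 := mulr_ge0 (ltW eta0) a0.
move: h1 h2 h3 h4 h5; lra.
Qed.

(** Three comparisons: the descent lemma holds at every outcome, replacing the updates [U n] by
    their moments holds only after integration, and [pathwise] holds again at almost every
    outcome. *)
Lemma flexfl_iteration : let y' w := y w - eta *: (N%:R^-1 *: \sum_n U n w) in
  square_integrable P y' /\
  \int[P]_w f (y' w) <= \int[P]_w f (y w)
    - eta / 4 * \int[P]_w enorm (gradient f (x w)) ^+ 2
    + eta * L ^+ 2 * \int[P]_w enorm (r w) ^+ 2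
    + (eta * L ^+ 2 / N%:R) * \sum_n \int[P]_w enorm (e n w) ^+ 2
    + (L * eta ^+ 2 * (eps ^+ 2 + sigma ^+ 2) / N%:R) *
        \sum_n \int[P]_w (q n w)^-1.
Proof.
move=> y'.
have sU n := (update n).1.
have sy' : square_integrable P y'.
  rewrite (_ : y' = fun w => y w + (- eta / N%:R) *: \sum_n U n w).
    by apply: square_integrableD => //; apply: square_integrableZ;
      exact: square_integrable_sum.
  by apply/funext => w; rewrite /y' scalerA -scaleNr mulNr.
split => //.
have ify := integrable_objective sy.
have sgy : square_integrable P (fun w => gradient f (y w)).
  exact: square_integrable_gradient sy.
have [_ igx] : square_integrable P (fun w => gradient f (x w)).
  exact: square_integrable_gradient sx.
have [i1 E1] := expand (- eta / N%:R) (L * eta ^+ 2 / 2 / N%:R) ify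
  (fun n => integrable_dotv sgy (sU n)) (fun n => (sU n).2).
have [i2 E2] := expand (- eta / N%:R) (L * eta ^+ 2 / 2 / N%:R) ify
  (fun n => integrable_dotv sgy (sm n)) iB.
have iZx := integrableZR (eta / 4) measurableT igx.
have iZr := integrableZR (eta * L ^+ 2) measurableT sr.2.
have iBx := integrableBR measurableT ify iZx.
have i30 := integrableDR measurableT iBx iZr.
have [i3 E3] := expand (eta * L ^+ 2 / N%:R)
  (L * eta ^+ 2 * (eps ^+ 2 + sigma ^+ 2) / N%:R) i30
  (fun n => (se n).2) integrable_inv_probability.
apply: (le_trans (ae_le_Rintegral (integrable_objective sy') i1 _)).
  apply: aeW => w; apply: le_trans (descent (y w) _) _.
  have -> : y' w - y w = (- eta / N%:R) *: \sum_n U n w.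
    by rewrite /y' addrAC subrr add0r scalerA -scaleNr mulNr.
  rewrite dotvZr dotv_sumr lerD2l.
  have -> : (- eta / N%:R) *: \sum_n U n w = (- eta) *: (N%:R^-1 *: \sum_n U n w).
    by rewrite scalerA.
  rewrite enorm_sqrZ sqrrN.
  have := enorm_mean_le (fun n => U n w) N0.
  have c0 : 0 <= L * eta ^+ 2 / 2.
    by rewrite divr_ge0// mulr_ge0 ?sqr_ge0// ltW.
  move=> /(ler_wpM2l c0); set A := enorm _ ^+ 2; set C := \sum_n _; lra.
rewrite E1; under eq_bigr do rewrite update_mean.
have L2 : 0 <= L * eta ^+ 2 / 2 / N%:R.
  by rewrite divr_ge0// divr_ge0// mulr_ge0 ?sqr_ge0// ltW.
apply: (@le_trans _ _ (\int[P]_w (f (y w) + (- eta / N%:R) *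
    \sum_n dotv (gradient f (y w)) (m n w)
    + (L * eta ^+ 2 / 2 / N%:R) * \sum_n B n w))).
  by rewrite E2 lerD2l ler_wpM2l//; apply: ler_sum => n _; exact: (update n).2.
apply: (le_trans (ae_le_Rintegral i2 i3 _)).
  by apply: filterS qp => w; exact: pathwise.
rewrite E3 (RintegralD measurableT iBx iZr) (RintegralB measurableT ify iZx).
by rewrite (RintegralZl _ measurableT igx) (RintegralZl _ measurableT sr.2).
Qed.

End Iteration.

(** * From integrals to expectations, and the theorem *)

Section Expectation.
Context (R : realType) (disp : measure_display) (Om : measurableType disp)
  (P : probability Om R).

Lemma expectation_RintegralE (X : Om -> R) :
  P.-integrable setT (EFin \o X) -> 'E_P[X]%E = (\int[P]_w X w)%:E.
Proof. by move=> iX; rewrite unlock fineK// integrable_fin_num. Qed.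

Lemma square_integrable_expectation (d : nat) (U : Om -> 'rV[R]_d) :
  measurable_coords U ->
  ('E_P[(fun w => enorm (U w) ^+ 2)%R] < +oo)%E -> square_integrable P U.
Proof.
move=> mU; rewrite unlock => Uoo; split => //; apply/integrableP; split.
  by apply/measurable_EFinP; exact: measurable_enorm_sqr.
by under eq_integral do rewrite /= ger0_norm ?sqr_ge0//.
Qed.

End Expectation.

Lemma lt_sum_ltey (R : realType) (I : finType) (X : I -> \bar R) i :
  (forall j, 0 <= X j)%E -> (\sum_j X j < +oo)%E -> (X i < +oo)%E.
Proof.
move=> X0; apply: le_lt_trans; rewrite (bigD1 i)//= leeDl//.
exact: sume_ge0.
Qed.

Theorem theorem1 (R : realType) (disp : measure_display)
    (Om : measurableType disp) (P : probability Om R)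
    (N T d : nat) (hN : (0 < N)%N) (hT : (0 < T)%N) (hd : (0 < d)%N)
    (F : 'I_N -> 'rV[R]_d -> R)
    (hF : forall n x, differentiable (F n) x)
    (fstar : R) (hfstar : is_minimum (average_objective F) fstar)
    (L sigma eps : R) (hL : 0 < L) (hsigma : 0 <= sigma) (heps : 0 <= eps)
    (hsmooth : forall n x y,
       enorm (gradient (F n) x - gradient (F n) y) <= L * enorm (x - y))
    (g : nat -> 'I_N -> 'rV[R]_d -> Om -> 'rV[R]_d)
    (hg : forall t n, (t < T)%N -> stochastic_gradient P (F n) sigma (g t n))
    (heterogeneity : forall n x,
       enorm (gradient (F n) x - gradient (average_objective F) x) ^+ 2
         <= eps ^+ 2)
    (eta : R) (heta : 0 < eta)
    (q : nat -> 'I_N -> Om -> R)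
    (hq : forall t n w, (t < T)%N -> 0 < q t n w <= 1)
    (I : nat -> 'I_N -> Om -> bool)
    (e b v : nat -> 'I_N -> Om -> 'rV[R]_d)
    (x r a u : nat -> Om -> 'rV[R]_d) (x0 : 'rV[R]_d)
    (hrun : flexfl_run T x0 eta g q I e b v x r a u)
    (Fil : nat -> set (set Om))
    (hinfo : flexfl_information T Fil g q I e v x r u)
    (hsampling : forall t n, (t < T)%N ->
       flexfl_sampling P (Fil t) (F n) sigma (q t n) (I t n) (x t)
         (fun w => g t n (x t w) w))
    (p : R)
    (hp : forall t, (t < T)%N ->
       {ae P, forall w, N%:R^-1 * \sum_(n < N) (q t n w)^-1 <= p})
    (hetap : eta <= (4 * L * p)^-1) :
  ((T%:R^-1)%:E *
     (\sum_(t < T)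
        'E_P[(fun w => enorm (gradient (average_objective F) (x t w)) ^+ 2)%R])
   <= (4 * (average_objective F x0 - fstar) / (eta * T%:R))%:E
    + (4 * L ^+ 2 / T%:R)%:E *
        (\sum_(t < T) 'E_P[(fun w => enorm (r t w) ^+ 2)%R])
    + (4 * L ^+ 2 / (N%:R * T%:R))%:E *
        (\sum_(t < T) \sum_(n < N) 'E_P[(fun w => enorm (e t n w) ^+ 2)%R])
    + (4 * eta * L * (eps ^+ 2 + sigma ^+ 2) / (N%:R * T%:R))%:E *
        (\sum_(t < T) \sum_(n < N) 'E_P[(fun w => (q t n w)^-1)%R]))%E.
Proof.
set f := average_objective F.
have NN0 : (0 : R) < N%:R by rewrite ltr0n.
have TT0 : (0 : R) < T%:R by rewrite ltr0n.
have [_ fmin] := hfstar.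
have lip n z w : enorm (gradient (F n) z - gradient (F n) w) ^+ 2
    <= L ^+ 2 * enorm (z - w) ^+ 2.
  rewrite -exprMn; apply: lerXn2r (hsmooth n z w); rewrite nnegrE ?enorm_ge0//.
  by rewrite mulr_ge0 ?enorm_ge0// ltW.
(* Inversion preserves signs and sends 0 to 0, so the bound on the positive [eta] forces [p] to be
   positive. *)
have p0 : 0 < p.
  have : 0 < (4 * L * p)^-1 by exact: lt_le_trans hetap.
  by rewrite invr_gt0 pmulr_rgt0// mulr_gt0.
have etap : eta * L * p <= 4^-1.
  have L4p : 0 < 4 * L * p by rewrite !mulr_gt0.
  by move: hetap; rewrite -[(_ * p)^-1]mul1r ler_pdivlMr//; lra.
have FilM t := info_measurable hinfo t.
have mcoord t (X : Om -> 'rV[R]_d) : rV_measurable (Fil t) X -> measurable_coords X.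
  by move=> GX i; apply: (real_measurable_sub (@FilM t)); exact: rV_measurableP.
set Er := (\sum_(t < T) 'E_P[(fun w => enorm (r t w) ^+ 2)%R])%E.
set Ee := (\sum_(t < T) \sum_(n < N) 'E_P[(fun w => enorm (e t n w) ^+ 2)%R])%E.
set Eq := (\sum_(t < T) \sum_(n < N) 'E_P[(fun w => (q t n w)^-1)%R])%E.
have Esqr_ge0 (U : Om -> 'rV[R]_d) : (0 <= 'E_P[(fun w => enorm (U w) ^+ 2)%R])%E.
  by apply: expectation_ge0 => w; rewrite sqr_ge0.
have Er0 : (0 <= Er)%E by apply: sume_ge0 => t _.
have Ee0 : (0 <= Ee)%E by apply: sume_ge0 => t _; apply: sume_ge0 => n _.
have cr : 0 < 4 * L ^+ 2 / T%:R by rewrite divr_gt0// mulr_gt0// exprn_gt0.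
have ce : 0 < 4 * L ^+ 2 / (N%:R * T%:R).
  by rewrite divr_gt0 ?mulr_gt0// exprn_gt0.
have cq : 0 <= 4 * eta * L * (eps ^+ 2 + sigma ^+ 2) / (N%:R * T%:R).
  by rewrite divr_ge0 ?mulr_ge0 ?addr_ge0 ?sqr_ge0// ltW.
have cqE : (0 <= (4 * eta * L * (eps ^+ 2 + sigma ^+ 2) / (N%:R * T%:R))%:E * Eq)%E.
  rewrite mule_ge0 ?lee_fin//; apply: sume_ge0 => t _; apply: sume_ge0 => n _.
  by apply: expectation_ge0 => w; rewrite invr_ge0; case/andP: (hq t n w (ltn_ord t)) => /ltW.
have cf : (0 <= (4 * (f x0 - fstar) / (eta * T%:R))%:E)%E.
  by rewrite lee_fin divr_ge0 ?mulr_ge0 ?subr_ge0//; exact: ltW.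
(* An infinite term absorbs the others only once these are known to differ from [-oo]. *)
have neqNy z : (0 <= z)%E -> z != -oo%E :> \bar R.
  by move=> z0; rewrite gt_eqF// (lt_le_trans _ z0)// ltNy0.
have crE : (0 <= (4 * L ^+ 2 / T%:R)%:E * Er)%E by rewrite mule_ge0// lee_fin ltW.
have ceE : (0 <= (4 * L ^+ 2 / (N%:R * T%:R))%:E * Ee)%E.
  by rewrite mule_ge0// lee_fin ltW.
have [Eroo|Erfin] := leP +oo%E Er.
  move: Eroo; rewrite leye_eq => /eqP ->; rewrite gt0_muley ?lte_fin//.
  by rewrite (addey (neqNy _ cf)) (addye (neqNy _ ceE)) (addye (neqNy _ cqE)) leey.
have [Eeoo|Eefin] := leP +oo%E Ee.
  move: Eeoo; rewrite leye_eq => /eqP ->; rewrite gt0_muley ?lte_fin//.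
  by rewrite (addey (neqNy _ (adde_ge0 cf crE))) (addye (neqNy _ cqE)) leey.
have sr t : (t < T)%N -> square_integrable P (r t).
  move=> tT; apply: square_integrable_expectation.
    exact: mcoord (info_r hinfo tT).
  exact: (lt_sum_ltey (Ordinal tT) _ Erfin).
have se t n : (t < T)%N -> square_integrable P (e t n).
  move=> tT; apply: square_integrable_expectation.
    by apply: (@mcoord t); exact: (info_e hinfo).
  have Eet : (\sum_n 'E_P[(fun w => enorm (e t n w) ^+ 2)%R] < +oo)%E.
    by apply: (lt_sum_ltey (Ordinal tT) _ Eefin) => j; exact: sume_ge0.
  exact: (lt_sum_ltey n _ Eet).
pose y t w := x t w + r t w + N%:R^-1 *: \sum_n e t n w.
have yS t w : (t < T)%N -> y t.+1 w = y t w - eta *: (N%:R^-1 *: \sum_n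
    ((I t n w)%:R / q t n w) *: g t n (x t w) w).
  move=> tT; rewrite /y (flexfl_x hrun)// (flexfl_r hrun)// (flexfl_a hrun)//.
  have -> : \sum_n e t.+1 n w = \sum_n (e t n w -
      (eta * (I t n w)%:R / q t n w) *: g t n (x t w) w - v t n w).
    by apply: eq_bigr => n _; rewrite (flexfl_e hrun)// (flexfl_b hrun).
  rewrite !sumrB !scalerBr.
  have -> : eta *: (N%:R^-1 *: \sum_n ((I t n w)%:R / q t n w) *: g t n (x t w) w) =
      N%:R^-1 *: \sum_n (eta * (I t n w)%:R / q t n w) *: g t n (x t w) w.
    rewrite scalerA mulrC -scalerA scaler_sumr; congr (_ *: _).
    by apply: eq_bigr => n _; rewrite scalerA mulrA.
  move: (N%:R^-1 *: _) (N%:R^-1 *: _) (N%:R^-1 *: _) => A B C.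
  by apply/rowP => i; rewrite !mxE; ring.
pose rho t := \int[P]_w enorm (r t w) ^+ 2.
pose eps2 t n := \int[P]_w enorm (e t n w) ^+ 2.
pose kap t n := \int[P]_w (q t n w)^-1.
pose gam t := \int[P]_w enorm (gradient f (x t w)) ^+ 2.
have sx t : (t < T)%N -> square_integrable P (y t) -> square_integrable P (x t).
  move=> tT sy.
  rewrite (_ : x t = fun w => y t w + (-1) *: (r t w + N%:R^-1 *: \sum_n e t n w)).
    apply: square_integrableD => //; apply: square_integrableZ.
    apply: square_integrableD; first exact: sr.
    by apply: square_integrableZ; apply: square_integrable_sum => n; exact: se.
  by apply/funext => w; rewrite /y scaleN1r -(addrA (x t w)) addrK.
have step t : (t < T)%N -> square_integrable P (y t) ->
    square_integrable P (y t.+1) /\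
    \int[P]_w f (y t.+1 w) <= \int[P]_w f (y t w) - eta / 4 * gam t
    + eta * L ^+ 2 * rho t + (eta * L ^+ 2 / N%:R) * \sum_n eps2 t n
    + (L * eta ^+ 2 * (eps ^+ 2 + sigma ^+ 2) / N%:R) * \sum_n kap t n.
  move=> tT sy.
  have -> : y t.+1 = fun w => y t w - eta *: (N%:R^-1 *: \sum_n
    ((I t n w)%:R / q t n w) *: g t n (x t w) w) by apply/funext => w; exact: yS.
  apply: (@flexfl_iteration R disp Om P N d hN F hF fstar L sigma eps eta p
    fmin hL lip (Fil t) (q t) (I t) (fun n w => g t n (x t w) w) (e t) (x t)
    (r t) (y t) (info_sigma_algebra hinfo t) (@FilM t) heterogeneity heta
    (fun n w => hq t n w tT) (hp t tT) etap) => //.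
  - by move=> n; exact: (info_q hinfo).
  (* The draws of iteration [t] become known only in [Fil t.+1]; plain measurability is all that is
     required of them here. *)
  - by move=> n Y HY; exact: (@FilM t.+1 _ (info_I hinfo tT HY)).
  - by move=> n Y HY; exact: (@FilM t.+1 _ (info_g hinfo tT HY)).
  - exact: (info_x hinfo).
  - exact: (info_r hinfo).
  - by move=> n; exact: (info_e hinfo).
  - by move=> n; exact: hsampling.
  - exact: sr.
  - by move=> n; exact: se.
have y0 : y 0%N = cst x0.
  apply/funext => w; rewrite /y (flexfl_x0 hrun) (flexfl_r0 hrun) addr0.
  by rewrite big1 ?scaler0 ?addr0// => n _; exact: flexfl_e0 hrun _ _.
have cstE (c : R) : \int[P]_w c = c.
  rewrite /Rintegral integral_cst//.
  by rewrite [X in (_ * X)%E](_ : _ = 1%E) ?mule1//; exact: probability_setT.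
(* Both claims go through one induction, since each step needs [y k] square integrable. At [k = T]
   this can come only from the recursion: the residuals of index [T] are absent from the right-hand
   side, so nothing bounds their moments. *)
have telescope k : (k <= T)%N -> square_integrable P (y k) /\
    eta / 4 * (\sum_(t < k) gam t) + \int[P]_w f (y k w) <= f x0
    + eta * L ^+ 2 * (\sum_(t < k) rho t)
    + (eta * L ^+ 2 / N%:R) * (\sum_(t < k) \sum_n eps2 t n)
    + (L * eta ^+ 2 * (eps ^+ 2 + sigma ^+ 2) / N%:R) * (\sum_(t < k) \sum_n kap t n).
  elim: k => [_|k ih kT].
    rewrite y0; split; first exact: square_integrable_cst.
    by rewrite !big_ord0 !mulr0 !addr0 add0r [leLHS](cstE (f x0)).
  have [sy hk] := ih (ltnW kT); have [sy' hk'] := step k kT sy; split => //.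
  rewrite !big_ord_recr/= !mulrDr; move: hk hk'; lra.
have [syT hT'] := telescope T (leqnn T).
have fstarT : fstar <= \int[P]_w f (y T w).
  rewrite -[leLHS]cstE; apply: ae_le_Rintegral; first exact: integrable_cstR.
    exact: (integrable_objective hN hF fmin hL lip syT).
  by apply: aeW => w; exact: fmin.
have gamE (t : 'I_T) : 'E_P[(fun w => enorm (gradient f (x t w)) ^+ 2)%R]%E = (gam t)%:E.
  apply: expectation_RintegralE.
  have [] := square_integrable_gradient (average_gradient_lipschitz hF hN lip)
    (sx t (ltn_ord t) (telescope t (ltnW (ltn_ord t))).1).
  by [].
have rhoE (t : 'I_T) : 'E_P[(fun w => enorm (r t w) ^+ 2)%R]%E = (rho t)%:E.
  by apply: expectation_RintegralE; case: (sr t (ltn_ord t)).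
have epsE (t : 'I_T) n : 'E_P[(fun w => enorm (e t n w) ^+ 2)%R]%E = (eps2 t n)%:E.
  by apply: expectation_RintegralE; case: (se t n (ltn_ord t)).
have kapE (t : 'I_T) n : 'E_P[(fun w => (q t n w)^-1)%R]%E = (kap t n)%:E.
  apply: expectation_RintegralE.
  apply: (integrable_inv_probability hN (q := q t) (@FilM t)
    (fun k w => hq t k w (ltn_ord t)) (hp t (ltn_ord t)) _) => k.
  exact: (info_q hinfo).
have -> : Er = (\sum_(t < T) rho t)%:E.
  by rewrite -sumEFin; apply: eq_bigr => t _; exact: rhoE.
have -> : Ee = (\sum_(t < T) \sum_n eps2 t n)%:E.
  rewrite -sumEFin; apply: eq_bigr => t _; rewrite -sumEFin.
  by apply: eq_bigr => n _; exact: epsE.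
have -> : Eq = (\sum_(t < T) \sum_n kap t n)%:E.
  rewrite -sumEFin; apply: eq_bigr => t _; rewrite -sumEFin.
  by apply: eq_bigr => n _; exact: kapE.
rewrite (eq_bigr (fun t : 'I_T => (gam t)%:E)); last by move=> t _; exact: gamE.
rewrite sumEFin -!EFinM -!EFinD lee_fin.
move: hT' fstarT; rewrite -/f.
move: (\sum_(t < T) gam t) (\sum_(t < T) rho t) (\sum_(t < T) \sum_n eps2 t n)
  (\sum_(t < T) \sum_n kap t n) (\int[P]_w f (y T w)) => a1 a2 a3 a4 a5 h1 h2.
(* Multiplying by T eta / 4 turns the claim into the telescoped bound, with E f(y_T) replaced by its
   lower bound [fstar]. *)
have c0 : 0 < T%:R * (eta / 4) by rewrite mulr_gt0// divr_gt0.
rewrite -(ler_pM2l c0).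
have -> : T%:R * (eta / 4) * (T%:R^-1 * a1) = eta / 4 * a1.
  by field; rewrite gt_eqF.
apply: (@le_trans _ _ (f x0 - fstar + eta * L ^+ 2 * a2 + eta * L ^+ 2 / N%:R * a3
    + L * eta ^+ 2 * (eps ^+ 2 + sigma ^+ 2) / N%:R * a4)); first by lra.
rewrite le_eqVlt; apply/orP; left; apply/eqP; field.
by rewrite !gt_eqF.
Qed.
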